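(* Let $G$ be an infinite, connected, locally finite graph (multiple edges allowed, no loops) that is smallish and symmetrical, regarded as an electric network in which every edge has resistance $1$ ohm. Then the average over the edges of $G$ of the even resistance across an edge, and the average over the edges of $G$ of the odd resistance across an edge, are equal, and both are equal to $2$ divided by the average valence of $G$: $$\mathrm{average\_even\_resistance}(G)=\mathrm{average\_odd\_resistance}(G)=\frac{2}{\mathrm{average\_valence}(G)}.$$
   Context: Networks: $G$ is treated as an electric network by giving every edge resistance $1$. A flow assigns a real number to each oriented edge, with opposite sign for the opposite orientation; its energy (dissipation) is the sum over all edges of (resistance)$\times$(flow)$^2$. The source strength of a flow at a vertex is the net flow out of that vertex. Swelling sequences: A swelling sequence is a sequence of finite sets $T$ of vertices of $G$ such that every finite set $S$ of vertices is contained in $T$ for all sufficiently late $T$ in the sequence. Cut and short graphs: For a finite set $S$ of vertices, $\mathrm{cut\_graph}(S)$ is the finite network obtained by discarding all vertices outside $S$ and all edges incident with discarded vertices. $\mathrm{short\_graph}(S)$ is the finite network obtained by identifying all vertices outside $S$ to a single new vertex $\infty$ (edges with both ends outside $S$ become loops at $\infty$, carry no current, and are discarded). Even and odd resistances: Let $p\neq q$ be vertices. The even flow from $p$ to $q$ is the limit, along any swelling sequence $T$, of the unit current flow from $p$ to $q$ in $\mathrm{cut\_graph}(T)$; the odd flow from $p$ to $q$ is the limit, along any swelling sequence $T$, of the unit current flow from $p$ to $q$ in $\mathrm{short\_graph}(T)$. (The odd flow is the unique minimum-energy flow among all flows on $G$ with source strength $+1$ at $p$, $-1$ at $q$, and $0$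 elsewhere; the even flow is the unique minimum-energy flow among the limits in the energy norm of such flows of finite support.) The even (respectively odd) resistance between $p$ and $q$ is the energy of the even (respectively odd) flow from $p$ to $q$. The even/odd resistance across an edge is the even/odd resistance between its two endpoints. Smallish graphs: For a finite set $S$ of vertices, $\mathrm{edge\_boundary}(S)$ is the set of edges joining a vertex in $S$ to a vertex outside $S$. A pinching sequence is a swelling sequence along which $|\mathrm{edge\_boundary}(T)|/|T|\to 0$. A graph is smallish if it has a pinching sequence. Symmetrical graphs: Two vertices (or two edges) are of the same kind if some automorphism of the graph maps one to the other. A graph is symmetrical if it has only finitely many kinds of vertices (equivalently, of edges). Averages: In a smallish symmetrical graph each kind of vertex has a well-defined relative frequency, namely the limit, along any pinching sequence $T$, of the proportion of the vertices of $\mathrm{cut\_graph}(T)$ that are of that kind; these are positive rational numbers summing to $1$. Likewise for kinds of edges, using the proportion of the edges of $\mathrm{cut\_graph}(T)$ of that kind. For a function depending only on the kind of a vertex (respectively edge), its average is the weighted mean of its values with the relative frequencies of the kinds as weights. Thus $\mathrm{average\_valence}(G)$ is the average of the valence (degree in $G$) over vertices, and $\mathrm{average\_even\_resistance}(G)$, $\mathrm{average\_odd\_resistance}(G)$ are the averages over edges of the even, odd resistance across an edge. *)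

(* Defs.v *)
From mathcomp Require Import all_boot all_order all_algebra finmap.
From mathcomp Require Import all_classical all_reals all_analysis.

Set Implicit Arguments.
Unset Strict Implicit.
Unset Printing Implicit Defensive.

Import Order.TTheory GRing.Theory Num.Theory.
Import numFieldNormedType.Exports.

Local Open Scope classical_set_scope.
Local Open Scope ring_scope.

(* [source] and [target] only fix an arbitrary reference orientation of each
   edge, used to give signs to flows; the graphs are undirected. *)
Record multigraph := Multigraph {
  vertex : choiceType;
  edge : choiceType;
  source : edge -> vertex;
  target : edge -> vertex }.

Definition loopless (G : multigraph) : Prop :=
  forall e : edge G, source e <> target e.

Definition incident_edges (G : multigraph) (v : vertex G) : set (edge G) :=
  [set e | source e = v \/ target e = v].

Definition locally_finite_graph (G : multigraph) : Prop :=
  forall v : vertex G, finite_set (incident_edges v).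

Definition infinite_graph (G : multigraph) : Prop :=
  infinite_set [set: vertex G].

Definition adjacent (G : multigraph) : rel (vertex G) := fun u v =>
  `[< exists e : edge G, (source e = u /\ target e = v) \/
                         (source e = v /\ target e = u) >].

Definition connected_graph (G : multigraph) : Prop :=
  forall u v : vertex G,
    exists s : seq (vertex G), path (@adjacent G) u s /\ last u s = v.

(* The value on an edge is the flow along its reference orientation; the flow
   along the opposite orientation is the opposite number. *)
Definition flow (R : realType) (G : multigraph) := edge G -> R.

Definition source_strength (R : realType) (G : multigraph) (j : flow R G)
    (v : vertex G) : R :=
  \sum_(e \in [set e | source e = v]) j e
  - \sum_(e \in [set e | target e = v]) j e.

Definition energy (R : realType) (G : multigraph) (j : flow R G) : \bar R :=
  \esum_(e in [set: edge G]) (j e ^+ 2)%:E.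

(* Kirchhoff's laws with unit resistances: the current along an edge is the
   potential drop along it. *)
Definition unit_current_flow (R : realType) (H : multigraph) (p q : vertex H)
    (j : flow R H) : Prop :=
  (forall v : vertex H, source_strength j v = (v == p)%:R - (v == q)%:R) /\
  (exists phi : vertex H -> R,
     forall e : edge H, j e = phi (source e) - phi (target e)).

Definition inside (G : multigraph) (S : {fset vertex G}) (e : edge G) : bool :=
  (source e \in S) && (target e \in S).

Definition touches (G : multigraph) (S : {fset vertex G}) (e : edge G) : bool :=
  (source e \in S) || (target e \in S).

Definition edge_boundary (G : multigraph) (S : {fset vertex G}) :
    set (edge G) :=
  [set e | (source e \in S) (+) (target e \in S)].

Definition cut_graph (G : multigraph) (S : {fset vertex G}) : multigraph :=
  @Multigraph S {e : edge G | inside S e}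
    (fun e => FSetSub (proj1 (andP (valP e))))
    (fun e => FSetSub (proj2 (andP (valP e)))).

(* The vertex at infinity is [None]: [insub v] is [Some v] if [v] is in [S]
   and [None] otherwise. *)
Definition short_graph (G : multigraph) (S : {fset vertex G}) : multigraph :=
  @Multigraph (option S) {e : edge G | touches S e}
    (fun e => insub (source (val e)))
    (fun e => insub (target (val e))).

Definition extend_by_zero (R : realType) (G : multigraph) (P : pred (edge G))
    (j : {e : edge G | P e} -> R) : flow R G :=
  fun e => if insub e is Some e' then j e' else 0.

Definition cut_current (R : realType) (G : multigraph) (S : {fset vertex G})
    (p q : vertex G) (i : flow R G) : Prop :=
  exists (p' q' : S) (j : flow R (cut_graph S)),
    [/\ val p' = p, val q' = q,
        @unit_current_flow R (cut_graph S) p' q' j & i = extend_by_zero j].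

Definition short_current (R : realType) (G : multigraph) (S : {fset vertex G})
    (p q : vertex G) (i : flow R G) : Prop :=
  exists (p' q' : S) (j : flow R (short_graph S)),
    [/\ val p' = p, val q' = q,
        @unit_current_flow R (short_graph S) (Some p') (Some q') j
      & i = extend_by_zero j].

Definition swelling (G : multigraph) (T : nat -> {fset vertex G}) : Prop :=
  forall S : {fset vertex G}, \forall n \near \oo, (S `<=` T n)%fset.

(* [i] is the limit, in the energy norm and along every swelling sequence, of
   the flows specified by [current] on the successive finite networks, which
   need only be defined from some rank on. *)
Definition is_limit_current (R : realType) (G : multigraph)
    (current : {fset vertex G} -> flow R G -> Prop) (i : flow R G) : Prop :=
  forall T : nat -> {fset vertex G}, swelling T ->
    exists j : nat -> flow R G,
      (\forall n \near \oo, current (T n) (j n)) /\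
      energy (fun e => j n e - i e) @[n --> \oo] --> 0%E.

Definition even_flow (R : realType) (G : multigraph) (p q : vertex G) :
    flow R G :=
  xget (fun=> 0)
    [set i | is_limit_current (fun S => @cut_current R G S p q) i].

Definition odd_flow (R : realType) (G : multigraph) (p q : vertex G) :
    flow R G :=
  xget (fun=> 0)
    [set i | is_limit_current (fun S => @short_current R G S p q) i].

(* Limits in the energy norm of currents in finite networks have finite
   energy, so that [fine] loses nothing. *)
Definition even_resistance (R : realType) (G : multigraph) (p q : vertex G) :
    R := fine (energy (@even_flow R G p q)).

Definition odd_resistance (R : realType) (G : multigraph) (p q : vertex G) :
    R := fine (energy (@odd_flow R G p q)).

(* Only used on finite sets. *)
Definition card_set (R : realType) (X : choiceType) (A : set X) : R :=
  (#|` fset_set A |)%:R.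

Definition valence (R : realType) (G : multigraph) (v : vertex G) : R :=
  card_set R (incident_edges v).

Definition pinching (R : realType) (G : multigraph)
    (T : nat -> {fset vertex G}) : Prop :=
  swelling T /\
  card_set R (edge_boundary (T n)) / card_set R [set` T n] @[n --> \oo] --> (0 : R).

Definition smallish (R : realType) (G : multigraph) : Prop :=
  exists T : nat -> {fset vertex G}, pinching R T.

Definition automorphism (G : multigraph) (f : vertex G -> vertex G)
    (g : edge G -> edge G) : Prop :=
  [/\ bijective f, bijective g &
      forall e : edge G,
        (source (g e) = f (source e) /\ target (g e) = f (target e)) \/
        (source (g e) = f (target e) /\ target (g e) = f (source e))].

Definition vertex_kind (G : multigraph) (v : vertex G) : set (vertex G) :=
  [set w | exists (f : vertex G -> vertex G) (g : edge G -> edge G),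
     automorphism f g /\ f v = w].

Definition edge_kind (G : multigraph) (e : edge G) : set (edge G) :=
  [set d | exists (f : vertex G -> vertex G) (g : edge G -> edge G),
     automorphism f g /\ g e = d].

Definition vertex_kinds (G : multigraph) : set (set (vertex G)) :=
  range (@vertex_kind G).

Definition edge_kinds (G : multigraph) : set (set (edge G)) :=
  range (@edge_kind G).

Definition symmetrical (G : multigraph) : Prop := finite_set (@vertex_kinds G).

Definition proportion (R : realType) (X : choiceType) (A K : set X) : R :=
  card_set R (A `&` K) / card_set R A.

Definition vertex_frequency (R : realType) (G : multigraph)
    (K : set (vertex G)) : R :=
  xget 0 [set x | forall T : nat -> {fset vertex G}, pinching R T ->
    proportion R [set` T n] K @[n --> \oo] --> x].

Definition edge_frequency (R : realType) (G : multigraph)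
    (K : set (edge G)) : R :=
  xget 0 [set x | forall T : nat -> {fset vertex G}, pinching R T ->
    proportion R [set e | inside (T n) e] K @[n --> \oo] --> x].

(* [xget 0 (f @` K)] is the common value of [f] on [K] when [f] is constant on
   the nonempty set [K]. *)
Definition average (R : realType) (X : choiceType) (kinds : set (set X))
    (frequency : set X -> R) (f : X -> R) : R :=
  \sum_(K \in kinds) frequency K * xget 0 (f @` K).

Definition average_valence (R : realType) (G : multigraph) : R :=
  average (@vertex_kinds G) (@vertex_frequency R G) (@valence R G).

Definition average_even_resistance (R : realType) (G : multigraph) : R :=
  average (@edge_kinds G) (@edge_frequency R G)
    (fun e => even_resistance R (source e) (target e)).

Definition average_odd_resistance (R : realType) (G : multigraph) : R :=
  average (@edge_kinds G) (@edge_frequency R G)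
    (fun e => odd_resistance R (source e) (target e)).

(* Main.v *)
Require Import Defs.
From mathcomp Require Import all_boot all_order all_algebra finmap.
From mathcomp Require Import all_classical all_reals all_analysis.
From mathcomp Require Import ring lra.

Set Implicit Arguments.
Unset Strict Implicit.
Unset Printing Implicit Defensive.

Import Order.TTheory GRing.Theory Num.Theory.
Import numFieldNormedType.Exports.

Local Open Scope classical_set_scope.
Local Open Scope ring_scope.

(** The proof is a squeeze around Foster's identity for finite networks.

Fix an edge [e].  In the network induced on a finite set [S], the unit current
between the endpoints of [e] is the orthogonal projection of the unit flow
along [e] onto the space of gradients of potentials, whether the outside of
[S] is cut off or shorted.  Hence its energy is its value on [e], the diagonal
entry at [e] of the matrix of a projection, and the resistances across all the
edges add up to the trace of this projection, which is the dimension of the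
space of gradients: at most [#|S|] for the cut network ([cut_foster]) and
exactly [#|S|] for the shorted one ([short_foster]).

When [S] grows, the cut resistances decrease and the shorted ones increase,
and the squared energy distance between two currents is the difference of the
resistances ([cut_diff], [short_diff]).  So the currents converge along the
directed set of finite sets ([monotone_net_limit]); the even resistance is the
infimum of the cut resistances, the odd resistance the supremum of the shorted
ones ([even_resistanceP], [odd_resistanceP]), and the odd one is at most the
even one.  Summing over the edges inside [S] gives, with Foster's identity,
  sum of even resistances <= #|S|,   sum of odd resistances >= #|S| - #|bd S|,
where [bd S] is the edge boundary ([sum_even_le], [sum_odd_ge]).

Counting the edges between two kinds of vertices from both sides shows that
the numbers of vertices of these kinds in [S] are proportional up to
#|bd S| ([edge_count_balance], [kind_ratio]).  By connectedness the
frequencies of the kinds exist, and every function that is invariant under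
automorphisms has an average which is the limit of its averages over a
pinching sequence ([average_vertex_limit], [average_edge_limit]).  The number
of edges inside [S] is about half the average valence times #|S|
([edge_count_density]).  After division by this number the two inequalities
put the average even resistance below, and the average odd resistance above,
2 divided by the average valence, while the odd one is at most the even one,
so that all three are equal. *)

(** * Orthogonal projections and their traces *)

(** If [u *m B *m B^T = 0], then the squared length of [u *m B] vanishes. *)
Lemma gram_unit (R : realFieldType) m n (B : 'M[R]_(m, n)) :
  row_free B -> B *m B^T \in unitmx.
Proof.
move=> Bfree; rewrite -row_free_unit -kermx_eq0; apply/eqP/row_matrixP => i.
set u := row i _; rewrite row0.
have : u *m (B *m B^T) = 0 by rewrite -row_mul mulmx_ker row0.
move/(congr1 (mulmx^~ u^T)); rewrite mul0mx mulmxA -mulmxA -trmx_mul.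
move/matrixP => /(_ ord0 ord0); rewrite !mxE => uB0.
have uB : u *m B = 0.
  apply/rowP => j; rewrite [RHS]mxE; apply/eqP; rewrite -sqrf_eq0.
  have /psumr_eq0P : \sum_k ((u *m B) ord0 k) ^+ 2 = 0.
    by rewrite -[RHS]uB0; apply: eq_bigr => k _; rewrite [X in _ = _ * X]mxE.
  by move=> ->// k _; apply: sqr_ge0.
by apply/eqP; move/eqP: uB; rewrite mulmx_free_eq0.
Qed.

(** The trace of an orthogonal projection is the dimension of its range. The
projection is built from a basis [B] of the row space as
[B^T *m invmx (B *m B^T) *m B]. *)
Lemma projection_mx (R : realFieldType) m n (A : 'M[R]_(m, n)) :
  exists P : 'M[R]_n,
    [/\ P^T = P, (P <= A)%MS, A *m P = A & \tr P = (\rank A)%:R].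
Proof.
have [B Bfree BA] : exists2 B : 'M[R]_(\rank A, n), row_free B & (B :=: A)%MS.
  by exists (row_base A); [exact: row_base_free | exact: eq_row_base].
have := gram_unit Bfree; set Q := B *m B^T => Qu.
have QT : Q^T = Q by rewrite trmx_mul trmxK.
exists (B^T *m invmx Q *m B); split.
- by rewrite !trmx_mul trmxK trmx_inv QT mulmxA. 
- by apply: mulmx_sub; rewrite BA.
- have /submxP[X AX] : (A <= B)%MS by rewrite BA.
  by rewrite [LHS](congr1 (mulmx^~ _) AX) !mulmxA -(mulmxA X) -/Q mulmxK.
- by rewrite -mulmxA mxtrace_mulC -mulmxA mulVmx// mxtrace1.
Qed.

(** The functions [a i] on [J] span a space of dimension at most [#|I|], with
equality if they are independent. Row [j] of [P] is the projection onto this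
space of the unit vector at [j]. For the coboundaries of the vertices of a
finite network the bounds on the trace are Foster's identity. *)
Lemma orthogonal_projection (R : realFieldType) (I J : finType)
    (a : I -> J -> R) :
  exists P : J -> J -> R,
    [/\ exists c : J -> I -> R, forall j k, P j k = \sum_i c j i * a i k,
        forall i j, \sum_k P j k * a i k = a i j,
        \sum_j P j j <= #|I|%:R &
        (forall x : I -> R,
           (forall j, \sum_i x i * a i j = 0) -> forall i, x i = 0) ->
        \sum_j P j j = #|I|%:R].
Proof.
pose A : 'M[R]_(#|I|, #|J|) := \matrix_(i, j) a (enum_val i) (enum_val j).
have aE i j : a i j = A (enum_rank i) (enum_rank j) by rewrite mxE !enum_rankK.
have [P [PT /submxP[C PC] AP trP]] := projection_mx A.
have trE : \sum_(j : J) P (enum_rank j) (enum_rank j) = (\rank A)%:R.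
  rewrite -trP /mxtrace (reindex (@enum_rank J)) //=.
  by exists enum_val => x _; rewrite ?enum_rankK ?enum_valK.
exists (fun j k => P (enum_rank j) (enum_rank k)); split.
- exists (fun j i => C (enum_rank j) (enum_rank i)) => j k.
  rewrite {1}PC mxE (reindex (@enum_rank I)) /=; last first.
    by exists enum_val => x _; rewrite ?enum_rankK ?enum_valK.
  by apply: eq_bigr => i _; rewrite aE.
- move=> i j; rewrite aE -[in RHS]AP [RHS]mxE (reindex (@enum_rank J)) /=; last first.
    by exists enum_val => x _; rewrite ?enum_rankK ?enum_valK.
  by apply: eq_bigr => k _; rewrite aE mulrC -[in LHS]PT; congr (_ * _); rewrite mxE.
- by rewrite trE ler_nat rank_leq_row.
- move=> inj; rewrite trE; congr (_%:R); apply/eqP.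
  change (row_free A); rewrite -kermx_eq0; apply/eqP/row_matrixP => r.
  set u := row r _; rewrite row0.
  have uA : u *m A = 0 by rewrite -row_mul mulmx_ker row0.
  have ux := inj (fun i => u ord0 (enum_rank i)).
  apply/rowP => i; rewrite [RHS]mxE -[i]enum_valK; apply: ux => j.
  have : (u *m A) ord0 (enum_rank j) = 0 by rewrite uA mxE.
  rewrite [X in X = 0 -> _]mxE; apply: etrans.
  rewrite [RHS](reindex (@enum_rank I)) /=; last first.
    by exists enum_val => x _; rewrite ?enum_rankK ?enum_valK.
  by apply: eq_bigr => k _; rewrite aE.
Qed.

(** * Weak form of Kirchhoff's laws *)

Definition gradient (R : realType) (G : multigraph) (psi : vertex G -> R)
    (e : edge G) : R := psi (source e) - psi (target e).

Definition touching (G : multigraph) (S : {fset vertex G}) : {fset edge G} :=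
  fset_set [set e | touches S e].

Lemma finite_touches (G : multigraph) (S : {fset vertex G}) :
  locally_finite_graph G -> finite_set [set e | touches S e].
Proof.
move=> Glf; apply: (@sub_finite_set _ _
  (\bigcup_(v in [set` S]) incident_edges v)) => [e /= /orP[] eS|].
- by exists (source e) => //; left.
- by exists (target e) => //; right.
by apply: bigcup_finite => // v _; apply: Glf.
Qed.

Lemma in_touching (G : multigraph) (S : {fset vertex G}) (e : edge G) :
  locally_finite_graph G -> (e \in touching S) = touches S e.
Proof.
by move=> Glf; rewrite in_fset_set ?inE//; [exact: asboolb|exact: finite_touches].
Qed.

Lemma inside_touches (G : multigraph) (S : {fset vertex G}) (e : edge G) :
  inside S e -> touches S e.
Proof. by rewrite /inside /touches => /andP[->]. Qed.

(** Kirchhoff's laws for the cut network, read on [G]. The node laws are tested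
against all potentials at once: the pairing of the current with a gradient is
the potential drop along [e]. In this form the sum may run over any finite set
of edges that contains those touching [S], so that currents in different
networks can be compared. *)
Definition weak_cut_current (R : realType) (G : multigraph) (S : {fset vertex G})
    (e : edge G) (i : flow R G) : Prop :=
  [/\ inside S e, forall f, ~~ inside S f -> i f = 0,
      exists phi, forall f, inside S f -> i f = gradient phi f &
      forall psi, \sum_(f <- touching S) i f * gradient psi f = gradient psi e].

(** The potentials are normalized to vanish at infinity, that is, outside [S]. An
edge [e] of the boundary is allowed; the unit flow then ends at infinity. *)
Definition weak_short_current (R : realType) (G : multigraph) (S : {fset vertex G})
    (e : edge G) (i : flow R G) : Prop :=
  (exists2 phi, forall v, v \notin S -> phi v = 0 &
                forall f, i f = gradient phi f) /\
  forall psi, (forall v, v \notin S -> psi v = 0) ->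
    \sum_(f <- touching S) i f * gradient psi f = gradient psi e.

Lemma source_strength_sub (R : realType) (E V : choiceType) (F : {fset E})
    (P : pred E) (s t : {e | P e} -> V) (j : {e | P e} -> R) (v : V) :
  (forall e, P e -> e \in F) ->
  @source_strength R (@Multigraph V {e | P e} s t) j v =
  \sum_(e <- F) oapp (fun f => j f * ((s f == v)%:R - (t f == v)%:R)) 0 (insub e).
Proof.
move=> PF; rewrite /source_strength /=.
pose r : seq {e | P e} := pmap insub F.
have ru : uniq r by rewrite pmap_sub_uniq// fset_uniq.
have rP f : f \in r by rewrite mem_pmap_sub; apply: PF; apply: valP.
have sumE (h : {e | P e} -> V) :
    \sum_(e \in [set e | h e = v]) j e = \sum_(e <- r) j e * (h e == v)%:R.
  have -> : [set e | h e = v] = [set` [pred e | h e == v]].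
    by apply/seteqP; split=> x /= /eqP.
  rewrite -(bigfs _ ru) => [|f _]; last by rewrite rP.
  by rewrite big_mkcond; apply: eq_bigr => f _ /=; case: eqP; rewrite ?mulr1 ?mulr0.
rewrite !sumE -sumrB -[RHS]big_pmap; apply: eq_bigr => f _.
by rewrite -mulrBr.
Qed.

Lemma extend_val (R : realType) (G : multigraph) (P : pred (edge G))
    (i : flow R G) :
  (forall f, ~~ P f -> i f = 0) ->
  i = extend_by_zero (fun f : {e : edge G | P e} => i (val f)).
Proof.
move=> i0; apply/funext => e; rewrite /extend_by_zero.
by case: insubP => [f _ <-//|/i0].
Qed.

(** Summation by parts: a gradient is a combination of the coboundaries of the
vertices of [S], provided that no vertex outside [S] matters. *)
Lemma gradient_sum (R : realType) (G : multigraph) (S : {fset vertex G})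
    (psi : vertex G -> R) (e : edge G) :
  (inside S e \/ forall v, v \notin S -> psi v = 0) ->
  gradient psi e =
  \sum_(v : S) psi (val v) * ((source e == val v)%:R - (target e == val v)%:R).
Proof.
move=> Spsi.
have sumE u : (u \in S \/ psi u = 0) ->
    \sum_(v : S) psi (val v) * (u == val v)%:R = psi u.
  case: (boolP (u \in S)) => [uS _|uS [//|psiu]].
    rewrite (bigD1 [` uS]%fset) //= eqxx mulr1 big1 ?addr0// => v vu.
    rewrite (_ : (u == _) = false) ?mulr0//; apply/negP => /eqP uv.
    by move/eqP: vu; apply; apply/val_inj.
  rewrite psiu big1// => v _; case: eqP => [uv|]; last by rewrite mulr0.
  by move: uS; rewrite uv (valP v).
under eq_bigr do rewrite mulrBr.
rewrite big_split sumrN /= !sumE//.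
- case: Spsi => [/andP[_ ?]|psi0]; first by left.
  by case: (boolP (target e \in S)) => [|/psi0]; [left|right].
- case: Spsi => [/andP[? _]|psi0]; first by left.
  by case: (boolP (source e \in S)) => [|/psi0]; [left|right].
Qed.

Lemma cut_currentP (R : realType) (G : multigraph) (S : {fset vertex G})
    (e : edge G) (i : flow R G) : locally_finite_graph G -> inside S e ->
  cut_current S (source e) (target e) i <-> weak_cut_current S e i.
Proof.
move=> Glf eS; have /andP[pS qS] := eS.
have ST f : inside S f -> f \in touching S.
  by move=> fS; rewrite in_touching// inside_touches.
split=> [[p [q [j [pE qE [jstr [phi jphi]] ->]]]]|[_ i0 [phi iphi] istr]].
  have phiE (v : S) : oapp phi 0 (insub (val v)) = phi v by rewrite valK.
  split => //.
  - by move=> f fS; rewrite /extend_by_zero insubN.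
  - exists (fun v => oapp phi 0 (insub v)) => f fS.
    rewrite /extend_by_zero insubT jphi /gradient/= -(phiE (FSetSub _)).
    by rewrite -(phiE (FSetSub (proj2 _))).
  - move=> psi.
    transitivity (\sum_(v : S) psi (val v) *
        @source_strength R (cut_graph S) j v).
      rewrite /cut_graph; under [RHS]eq_bigr do
        rewrite (source_strength_sub _ _ _ _ ST) big_distrr.
      rewrite exchange_big; apply: eq_bigr => f _ /=.
      rewrite /extend_by_zero; case: insubP => [f' /= fS <-|_] /=; last first.
        by rewrite mul0r big1// => v _; rewrite mulr0.
      rewrite (@gradient_sum _ _ S) ?(valP f'); last by left.
      rewrite mulr_sumr; apply: eq_bigr => v _; rewrite mulrCA.
      by rewrite -!(inj_eq val_inj).
    rewrite (@gradient_sum _ _ S); last by left.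
    apply: eq_bigr => v _; rewrite jstr -!(inj_eq val_inj)/= pE qE.
    by rewrite ![val v == _]eq_sym.
exists [` pS]%fset, [` qS]%fset, (fun f => i (val f)); split=> //; last exact: extend_val.
split=> [v|]; last first.
  by exists (fun v => phi (val v)) => f; rewrite iphi ?(valP f).
(* Testing against the indicator of [v] recovers the node law at [v]. *)
have := istr (fun w => (w == val v)%:R); rewrite /gradient => istrv.
rewrite -!(inj_eq val_inj)/= ![val v == _]eq_sym -istrv /cut_graph.
rewrite (source_strength_sub _ _ _ _ ST).
apply: eq_bigr => f _; case: insubP => [f' /= fS <-|/i0 ->] /=; last by rewrite mul0r.
by rewrite -!(inj_eq val_inj).
Qed.

(** The node law at infinity is not part of the weak form. It follows from the
others by testing against the indicator of [S], because the strengths of the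
sources add up to zero. *)
Lemma short_currentP (R : realType) (G : multigraph) (S : {fset vertex G})
    (e : edge G) (i : flow R G) : locally_finite_graph G -> inside S e ->
  short_current S (source e) (target e) i <-> weak_short_current S e i.
Proof.
move=> Glf eS; have /andP[pS qS] := eS.
have ST f : touches S f -> f \in touching S by move=> fS; rewrite in_touching.
have insubE (u : vertex G) (v : S) : (insub u == Some v) = (u == val v).
  case: insubP => [u' _ <- //|uS].
  by apply/esym/negP => /eqP uv; rewrite uv (valP v) in uS.
split=> [[p [q [j [pE qE [jstr [phi jphi]] ->]]]]|[[phi phi0 iphi] istr]].
  split => //.
  - exists (fun v => phi (insub v) - phi None) => [v vS|f].
      by rewrite insubN// subrr.
    rewrite /extend_by_zero /gradient; case: insubP => [f' _ <-|]/=.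
      by rewrite jphi /= opprB addrA subrK.
    by rewrite /touches negb_or => /andP[fs ft]; rewrite !insubN// !subrr.
  - move=> psi psi0.
    transitivity (\sum_(v : S) psi (val v) *
        @source_strength R (short_graph S) j (Some v)).
      rewrite /short_graph; under [RHS]eq_bigr do
        rewrite (source_strength_sub _ _ _ _ ST) big_distrr.
      rewrite exchange_big; apply: eq_bigr => f _ /=.
      rewrite /extend_by_zero; case: insubP => [f' /= fS <-|_] /=; last first.
        by rewrite mul0r big1// => v _; rewrite mulr0.
      rewrite (@gradient_sum _ _ S); last by right.
      rewrite mulr_sumr; apply: eq_bigr => v _; rewrite mulrCA.
      by rewrite !insubE.
    rewrite (@gradient_sum _ _ S); last by left.
    apply: eq_bigr => v _; rewrite jstr.
    by rewrite !(inj_eq Some_inj) -!(inj_eq val_inj)/= pE qE ![val v == _]eq_sym.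
exists [` pS]%fset, [` qS]%fset, (fun f => i (val f)); split=> //; last first.
  apply: extend_val => f; rewrite /touches negb_or => /andP[fs ft].
  by rewrite iphi /gradient !phi0// subrr.
split=> [x|]; last first.
  exists (fun o => oapp (fun v : S => phi (val v)) 0 o) => f.
  rewrite iphi /gradient /=; congr (_ - _).
    by case: insubP => [u _ <-//|/phi0].
  by case: insubP => [u _ <-//|/phi0].
rewrite /short_graph (source_strength_sub _ _ _ _ ST).
have sumE (psi : vertex G -> R) :
    (forall w, psi w = (insub w == x)%:R) ->
    \sum_(f <- touching S) oapp (fun f' : {f | touches S f} => i (val f') *
      ((insub (source (val f')) == x)%:R - (insub (target (val f')) == x)%:R)) 0
      (insub f) = \sum_(f <- touching S) i f * gradient psi f.
  move=> psiE; apply: eq_bigr => f _; case: insubP => [f' _ <-|/=].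
    by rewrite /gradient !psiE.
  rewrite /touches negb_or => /andP[fs ft].
  by rewrite iphi /gradient !phi0// subrr mul0r.
pose psi (w : vertex G) : R := (insub w == x)%:R.
rewrite (sumE psi)//; case: x @psi {sumE} => [v|] psi.
  rewrite istr => [|w wS]; last by rewrite /psi insubN.
  rewrite /gradient /psi !insubE !(inj_eq Some_inj) -!(inj_eq val_inj)/=.
  by rewrite ![val v == _]eq_sym.
have psiE w : psi w = 1 - (w \in S)%:R.
  by rewrite /psi; case: insubP => [w' -> _|/negbTE ->]; rewrite ?subrr ?subr0.
have gradE f : gradient psi f = - gradient (fun w => (w \in S)%:R) f.
  by rewrite /gradient !psiE; ring.
under eq_bigr do rewrite gradE mulrN.
rewrite sumrN istr => [|w /negbTE -> //].
by rewrite /gradient pS qS subrr oppr0 /= addr0.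
Qed.

(** * Energies of currents in finite networks *)

Lemma sum_superset (V : nmodType) (X : choiceType) (A F : {fset X}) (h : X -> V) :
  (A `<=` F)%fset -> (forall x, x \notin A -> h x = 0) ->
  \sum_(x <- F) h x = \sum_(x <- A) h x.
Proof.
move=> AF h0; rewrite -(fsbigTE A h h0); apply/esym/(fsbigTE F h) => x xF.
by apply: h0; apply: contra xF; apply/fsubsetP.
Qed.

Section Currents.
Context (R : realType) (G : multigraph).
Hypothesis Glf : locally_finite_graph G.
Implicit Types (S T : {fset vertex G}) (F : {fset edge G}) (e f : edge G)
  (i j : flow R G) (psi : vertex G -> R).

Lemma inside_sub S T e : (S `<=` T)%fset -> inside S e -> inside T e.
Proof. by move=> /fsubsetP ST /andP[sS tS]; rewrite /inside !ST. Qed.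

Lemma touching_sub S T : (S `<=` T)%fset -> (touching S `<=` touching T)%fset.
Proof.
move=> /fsubsetP ST; apply/fsubsetP => f; rewrite !in_touching//.
by rewrite /touches => /orP[/ST->|/ST->]; rewrite ?orbT.
Qed.

Lemma gradient_off S psi f :
  (forall v, v \notin S -> psi v = 0) -> f \notin touching S ->
  gradient psi f = 0.
Proof.
move=> psi0; rewrite in_touching// /touches negb_or => /andP[fs ft].
by rewrite /gradient !psi0// subrr.
Qed.

Lemma cut_off S e i f : weak_cut_current S e i -> f \notin touching S -> i f = 0.
Proof.
case=> _ i0 _ _; rewrite in_touching// => fS; apply: i0.
by apply: contra fS; apply: inside_touches.
Qed.

Lemma short_off S e i f : weak_short_current S e i -> f \notin touching S -> i f = 0.
Proof. by case=> -[phi phi0 ->] _; apply: gradient_off. Qed.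

Lemma cut_dot S e i F psi : weak_cut_current S e i -> (touching S `<=` F)%fset ->
  \sum_(f <- F) i f * gradient psi f = gradient psi e.
Proof.
move=> iS SF; have [_ _ _ <-] := iS; apply: sum_superset => // f fS.
by rewrite (cut_off iS)// mul0r.
Qed.

Lemma short_dot S e i F psi : weak_short_current S e i -> (touching S `<=` F)%fset ->
  (forall v, v \notin S -> psi v = 0) ->
  \sum_(f <- F) i f * gradient psi f = gradient psi e.
Proof.
move=> iS SF psi0; have [_ <- //] := iS; apply: sum_superset => // f fS.
by rewrite (short_off iS)// mul0r.
Qed.

Lemma sum_sqrB F i j :
  \sum_(f <- F) (i f - j f) ^+ 2 = \sum_(f <- F) i f * i f
    - 2 * \sum_(f <- F) i f * j f + \sum_(f <- F) j f * j f.
Proof.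
rewrite big_distrr /= -sumrB -big_split; apply: eq_bigr => f _ /=.
by rewrite sqrrB !expr2 mulr2n mulrDl mul1r.
Qed.

(** The smaller current lives on edges where the larger one is a gradient. *)
Lemma cut_cut_dot S T e i j F : weak_cut_current S e i -> weak_cut_current T e j ->
    (S `<=` T)%fset -> (touching S `<=` F)%fset ->
  \sum_(f <- F) i f * j f = j e.
Proof.
move=> iS jT ST SF; have [eT _ [phi jphi] _] := jT.
rewrite jphi// -(cut_dot phi iS SF); apply: eq_bigr => f _.
have [fT|fT] := boolP (inside T f); first by rewrite jphi.
have [_ i0 _ _] := iS; rewrite i0 ?mul0r//.
by apply: contra fT; apply: inside_sub.
Qed.

(** The smaller current is a gradient of a potential that may be used to test the
larger one. *)
Lemma short_short_dot S T e i j F :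
    weak_short_current S e i -> weak_short_current T e j ->
    (S `<=` T)%fset -> (touching T `<=` F)%fset ->
  \sum_(f <- F) j f * i f = i e.
Proof.
move=> iS jT ST TF; have [[phi phi0 iphi] _] := iS.
rewrite iphi -(short_dot jT TF); first by apply: eq_bigr => f _; rewrite iphi.
by move=> v vT; apply: phi0; apply: contra vT; apply/fsubsetP.
Qed.

(** The cut current satisfies the node laws at all vertices of [G], so that the
potential of any shorted current may be used to test it. *)
Lemma cut_short_dot S T e i j F : weak_short_current S e i -> weak_cut_current T e j ->
    (touching T `<=` F)%fset ->
  \sum_(f <- F) j f * i f = i e.
Proof.
move=> iS jT TF; have [[phi phi0 iphi] _] := iS.
by rewrite iphi -(cut_dot phi jT TF); apply: eq_bigr => f _; rewrite iphi.
Qed.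

Lemma cut_energy S e i F : weak_cut_current S e i -> (touching S `<=` F)%fset ->
  \sum_(f <- F) i f ^+ 2 = i e.
Proof.
move=> iS SF; rewrite -[RHS](cut_cut_dot iS iS (fsubset_refl _) SF).
by apply: eq_bigr => f _; rewrite expr2.
Qed.

Lemma short_energy S e i F : weak_short_current S e i -> (touching S `<=` F)%fset ->
  \sum_(f <- F) i f ^+ 2 = i e.
Proof.
move=> iS SF; rewrite -[RHS](short_short_dot iS iS (fsubset_refl _) SF).
by apply: eq_bigr => f _; rewrite expr2.
Qed.

Lemma ler_sum_fset F F' (h : edge G -> R) : (F `<=` F')%fset ->
  (forall f, 0 <= h f) -> \sum_(f <- F) h f <= \sum_(f <- F') h f.
Proof.
move=> FF' h0; rewrite (big_fsetID _ (mem F) F') /=.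
rewrite (_ : [fset x in F' | x \in F]%fset = F).
  by rewrite lerDl sumr_ge0.
apply/fsetP => f; rewrite !inE /= andbC.
by case: (boolP (f \in F)) => //= fF; apply: (fsubsetP FF').
Qed.

(** Pythagoras: the larger current is the projection of the smaller one, and the
energy of a current is its value on [e]. *)
Lemma cut_diff S T e i j F : weak_cut_current S e i -> weak_cut_current T e j ->
    (S `<=` T)%fset ->
  \sum_(f <- F) (i f - j f) ^+ 2 <= i e - j e.
Proof.
move=> iS jT ST; have sT := touching_sub ST.
apply: le_trans (ler_sum_fset (fsubsetUl F (touching T)) _) _ => [f|].
  exact: sqr_ge0.
have TF : (touching T `<=` F `|` touching T)%fset by apply: fsubsetUr.
have SF := fsubset_trans sT TF.
rewrite sum_sqrB (cut_cut_dot iS iS)// (cut_cut_dot iS jT)// (cut_cut_dot jT jT)//.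
by lra.
Qed.

(** Pythagoras; now the smaller current is the projection of the larger one. *)
Lemma short_diff S T e i j F : weak_short_current S e i -> weak_short_current T e j ->
    (S `<=` T)%fset ->
  \sum_(f <- F) (i f - j f) ^+ 2 <= j e - i e.
Proof.
move=> iS jT ST; have sT := touching_sub ST.
apply: le_trans (ler_sum_fset (fsubsetUl F (touching T)) _) _ => [f|].
  exact: sqr_ge0.
have TF : (touching T `<=` F `|` touching T)%fset by apply: fsubsetUr.
have SF := fsubset_trans sT TF.
under eq_bigr do rewrite -sqrrN opprB.
rewrite sum_sqrB (short_short_dot iS iS)// (short_short_dot iS jT)//.
by rewrite (short_short_dot jT jT)//; lra.
Qed.

(** Rayleigh's principle; the shorted current is a projection of the cut one. *)
Lemma short_le_cut S T e i j :
  weak_short_current S e i -> weak_cut_current T e j -> i e <= j e.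
Proof.
move=> iS jT; pose F := (touching S `|` touching T)%fset.
have TF : (touching T `<=` F)%fset by apply: fsubsetUr.
have SF : (touching S `<=` F)%fset by apply: fsubsetUl.
have : 0 <= \sum_(f <- F) (j f - i f) ^+ 2 by apply: sumr_ge0 => f _; apply: sqr_ge0.
rewrite sum_sqrB (cut_cut_dot jT jT)// (short_short_dot iS iS)//.
by rewrite (cut_short_dot iS jT)//; lra.
Qed.

(** The term of the sum at [e] alone gives [h e ^+ 2 <= h e]. *)
Lemma sqr_sum_le1 (F : {fset edge G}) (h : edge G -> R) e :
  e \in F -> \sum_(f <- F) h f ^+ 2 = h e -> h e <= 1.
Proof.
move=> eF he; have : h e ^+ 2 <= h e.
  rewrite -[X in _ <= X]he (big_fsetD1 e)//= lerDl.
  by apply: sumr_ge0 => f _; apply: sqr_ge0.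
by nra.
Qed.

Lemma cut_ge0 S e i : weak_cut_current S e i -> 0 <= i e.
Proof.
move=> iS; rewrite -(cut_energy iS (fsubset_refl _)).
by apply: sumr_ge0 => f _; apply: sqr_ge0.
Qed.

Lemma short_le1 S e i : weak_short_current S e i -> i e <= 1.
Proof.
move=> iS; have [eT|/(short_off iS) ->//] := boolP (e \in touching S).
by apply: (@sqr_sum_le1 (touching S)) => //; apply: (short_energy iS).
Qed.

Lemma cut_unique S e i j :
  weak_cut_current S e i -> weak_cut_current S e j -> i = j.
Proof.
move=> iS jS; apply/funext => f.
have := cut_diff [fset f]%fset iS jS (fsubset_refl _).
have := cut_diff [fset f]%fset jS iS (fsubset_refl _).
rewrite !big_seq_fset1 => h1 h2.
apply/eqP; rewrite -subr_eq0 -sqrf_eq0 eq_le sqr_ge0 andbT.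
by move: h1; rewrite -sqrrN opprB; lra.
Qed.

Lemma short_unique S e i j :
  weak_short_current S e i -> weak_short_current S e j -> i = j.
Proof.
move=> iS jS; apply/funext => f.
have := short_diff [fset f]%fset iS jS (fsubset_refl _).
have := short_diff [fset f]%fset jS iS (fsubset_refl _).
rewrite !big_seq_fset1 => h1 h2.
apply/eqP; rewrite -subr_eq0 -sqrf_eq0 eq_le sqr_ge0 andbT.
by move: h1; rewrite -sqrrN opprB; lra.
Qed.

(** Apply [orthogonal_projection] to the coboundaries of the vertices of [S],
restricted to the edges inside [S]. *)
Lemma cut_foster S : exists J : edge G -> flow R G,
  (forall e, inside S e -> weak_cut_current S e (J e)) /\
  \sum_(e <- touching S | inside S e) J e e <= #|` S|%:R.
Proof.
pose a (v : S) (f : touching S) : R := if inside S (val f) then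
  (source (val f) == val v)%:R - (target (val f) == val v)%:R else 0.
have [P [[c Pc] Pa Ptr _]] := orthogonal_projection a.
have P0 (e f : touching S) : ~~ inside S (val f) -> P e f = 0.
  by move=> /negbTE fS; rewrite Pc big1// => v _; rewrite /a fS mulr0.
pose J e f : R := oapp (fun e' : touching S =>
  oapp (fun f' : touching S => P e' f') 0 (insub f)) 0 (insub e).
exists J; split=> [e eS|]; last first.
  rewrite cardfE; apply: le_trans Ptr; rewrite big_mkcond big_seq_fsetE /=.
  apply: ler_sum => e _; case: ifPn => [_|/P0 ->//].
  by rewrite /J valK.
have eT : e \in touching S by rewrite in_touching// inside_touches.
have JE f : J e f = oapp (fun f' : touching S => P [` eT]%fset f') 0 (insub f).
  by rewrite /J -[e in LHS]/(val [` eT]%fset) valK.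
split=> //.
- by move=> f fS; rewrite JE; case: insubP => [f' _ fE|//]; apply: P0; rewrite fE.
- pose phi w := oapp (fun v : S => c [` eT]%fset v) 0 (insub w).
  exists phi => f fS.
  have fT : f \in touching S by rewrite in_touching// inside_touches.
  rewrite JE -[f in LHS]/(val [` fT]%fset) valK /= Pc (@gradient_sum _ _ S);
    last by left.
  by apply: eq_bigr => v _; rewrite /phi valK /a /= fS.
- move=> psi; rewrite (@gradient_sum _ _ S) //; last by left.
  rewrite big_seq_fsetE /=.
  transitivity (\sum_(v : S) psi (val v) * \sum_f P [` eT]%fset f * a v f).
    under [RHS]eq_bigr do rewrite big_distrr /=.
    rewrite exchange_big; apply: eq_bigr => f _ /=; rewrite JE valK /=.
    have [fS|fS] := boolP (inside S (val f)); last first.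
      by rewrite P0// mul0r big1// => v _; rewrite mul0r mulr0.
    rewrite (@gradient_sum _ _ S) //; last by left.
    by rewrite big_distrr; apply: eq_bigr => v _ /=; rewrite mulrCA /a fS.
  by apply: eq_bigr => v _; rewrite Pa /a /= eS.
Qed.

Lemma connected_constant (Gconn : connected_graph G) psi :
  (forall f, gradient psi f = 0) -> forall u v, psi u = psi v.
Proof.
move=> psi0 u v; have [s [us <-]] := Gconn u v.
elim: s u us => //= w s IHs u /andP[/asboolP[f uw] ws].
rewrite -IHs//; move/eqP: (psi0 f); rewrite subr_eq0 => /eqP.
by case: uw => -[-> ->].
Qed.

Lemma infinite_notin (Ginf : infinite_graph G) S : exists v, v \notin S.
Proof.
apply: contrapT => h; apply: Ginf; apply: sub_finite_set (finite_fset S) => v _ /=.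
by apply: contrapT => vS; apply: h; exists v; apply/negP.
Qed.

(** The coboundaries of the vertices of [S] are independent, since a potential
with vanishing gradient is constant by connectedness, and zero because it
vanishes at some vertex outside the finite set [S]. *)
Lemma short_foster (Gconn : connected_graph G) (Ginf : infinite_graph G) S :
  exists J : edge G -> flow R G,
  (forall e, e \in touching S -> weak_short_current S e (J e)) /\
  \sum_(e <- touching S) J e e = #|` S|%:R.
Proof.
pose a (v : S) (f : touching S) : R :=
  (source (val f) == val v)%:R - (target (val f) == val v)%:R.
have [P [[c Pc] Pa _ Ptr]] := orthogonal_projection a.
pose ext (x : S -> R) w := oapp x 0 (insub w).
have ext0 x w : w \notin S -> ext x w = 0 by move=> wS; rewrite /ext insubN.
have extE (x : S -> R) (f : touching S) : \sum_v x v * a v f = gradient (ext x) (val f).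
  rewrite (@gradient_sum _ _ S); last by right; apply: ext0.
  by apply: eq_bigr => v _; rewrite /ext valK.
pose J e f : R := oapp (fun e' : touching S =>
  oapp (fun f' : touching S => P e' f') 0 (insub f)) 0 (insub e).
exists J; split=> [e eT|]; last first.
  rewrite cardfE -Ptr.
    by rewrite big_seq_fsetE; apply: eq_bigr => e _; rewrite /J valK.
  move=> x x0 v; have [w wS] := infinite_notin Ginf S.
  have -> : x v = ext x (val v) by rewrite /ext valK.
  rewrite -(ext0 x w wS); apply: connected_constant => // f.
  have [fT|] := boolP (f \in touching S); last by apply: gradient_off (ext0 x).
  by rewrite -(x0 [` fT]%fset) extE.
have JE f : J e f = oapp (fun f' : touching S => P [` eT]%fset f') 0 (insub f).
  by rewrite /J -[e in LHS]/(val [` eT]%fset) valK.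
split.
  exists (ext (c [` eT]%fset)); first exact: ext0.
  move=> f; rewrite JE; case: insubP => [f' _ <-|fT] /=; first by rewrite Pc extE.
  by rewrite (gradient_off (@ext0 _)).
move=> psi psi0; rewrite (@gradient_sum _ _ S) //; last by right.
rewrite big_seq_fsetE /=.
transitivity (\sum_(v : S) psi (val v) * \sum_f P [` eT]%fset f * a v f).
  under [RHS]eq_bigr do rewrite big_distrr /=.
  rewrite exchange_big; apply: eq_bigr => f _ /=; rewrite JE valK /=.
  rewrite (@gradient_sum _ _ S) //; last by right.
  by rewrite big_distrr; apply: eq_bigr => v _ /=; rewrite mulrCA /a.
by apply: eq_bigr => v _; rewrite Pa /a.
Qed.
End Currents.

Lemma sqrD_le (R : realFieldType) (t a b : R) : 0 < t ->
  (a + b) ^+ 2 <= (1 + t) * a ^+ 2 + (1 + t^-1) * b ^+ 2.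
Proof.
move=> t0; have : 0 <= t^-1 * (t * a - b) ^+ 2 by rewrite mulr_ge0 ?invr_ge0 ?sqr_ge0 ?ltW.
have -> : t^-1 * (t * a - b) ^+ 2 = t * a ^+ 2 - 2 * a * b + t^-1 * b ^+ 2.
  by field; rewrite gt_eqF.
by move=> h; rewrite -subr_ge0; move: h; congr (0 <= _); ring.
Qed.

(** The form in which an inequality between energies follows from [sum_sqrD_le],
a substitute for the triangle inequality that involves no square roots. *)
Lemma le_of_almost (R : realFieldType) (x y : R) : 0 <= y ->
  (forall t, 0 < t -> exists2 C, 0 < C &
     forall eps, 0 < eps -> x <= (1 + t) * y + C * eps) ->
  x <= y.
Proof.
move=> y0 h; apply/ler_addgt0Pr => eta eta0.
(* This choice makes [t * y] at most [eta / 2]. *)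
pose t := eta / 2 / (y + 1).
have [|C C0] := h t; first by rewrite !divr_gt0// ltr_wpDl.
move=> /(_ (eta / 2 / C)); rewrite !divr_gt0// => /(_ isT).
rewrite [X in _ + X]mulrC divfK ?gt_eqF//.
have : t * y <= eta / 2.
  have y1 : y / (y + 1) <= 1 by rewrite ler_pdivrMr ?mul1r ?lerDl// ltr_wpDl.
  by rewrite /t mulrAC -mulrA; nra.
lra.
Qed.

Lemma sum_sqrD_le (R : realFieldType) (X : Type) (F : seq X) (t : R)
    (a b : X -> R) : 0 < t ->
  \sum_(f <- F) (a f + b f) ^+ 2 <=
  (1 + t) * \sum_(f <- F) a f ^+ 2 + (1 + t^-1) * \sum_(f <- F) b f ^+ 2.
Proof.
move=> t0; rewrite !big_distrr -big_split /=.
by apply: ler_sum => f _; apply: sqrD_le.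
Qed.

(** * Limits of currents in the energy norm *)

Section Energy.
Context (R : realType) (G : multigraph).
Implicit Types (i : flow R G) (F : {fset edge G}).

Lemma energy_ge F i : ((\sum_(f <- F) i f ^+ 2)%:E <= energy i)%E.
Proof.
apply: esum_ge; exists [set` F]; first by split=> //; apply: finite_fset.
by rewrite -fsbig_seq ?fset_uniq// sumEFin.
Qed.

Lemma energy_le i c :
  (forall F, \sum_(f <- F) i f ^+ 2 <= c) -> (energy i <= c%:E)%E.
Proof.
move=> ic; apply: ge_ereal_sup => _ [A [Afin _] <-].
rewrite fsbig_finite//= sumEFin lee_fin; apply: ic.
Qed.

Lemma energy_ge0 i : (0 <= energy i)%E.
Proof. by apply: esum_ge0 => f _; rewrite lee_fin sqr_ge0. Qed.
End Energy.

(** Let [delta S] be the square root of [sup D - D S]. The intervals of centre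
[J S f] and radius [delta S] meet pairwise, as two sets [S] and [T] are
compared through their union. The supremum of the left ends of these intervals is the
limit at [f]. *)
Lemma monotone_net_limit (R : realType) (V E : choiceType)
    (J : {fset V} -> E -> R) (D : {fset V} -> R) (B : R) (S0 : {fset V}) :
  (forall S T (F : {fset E}), (S0 `<=` S)%fset -> (S `<=` T)%fset ->
     \sum_(f <- F) (J S f - J T f) ^+ 2 <= D T - D S) ->
  (forall S, (S0 `<=` S)%fset -> D S <= B) ->
  exists i r, [/\
    forall S, (S0 `<=` S)%fset -> D S <= r,
    forall eps, 0 < eps ->
      exists2 S1, (S0 `<=` S1)%fset &
        forall S, (S1 `<=` S)%fset -> r - eps < D S &
    forall S (F : {fset E}), (S0 `<=` S)%fset ->
      \sum_(f <- F) (J S f - i f) ^+ 2 <= r - D S].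
Proof.
move=> JD DB.
have Dmono S T : (S0 `<=` S)%fset -> (S `<=` T)%fset -> D S <= D T.
  by move=> S0S ST; have := JD _ _ fset0 S0S ST; rewrite big_seq_fset0 subr_ge0.
pose A := [set D S | S in [set S | (S0 `<=` S)%fset]].
have supA : has_sup A.
  split; first by exists (D S0), S0; rewrite /= ?fsubset_refl.
  by exists B => _ [S S0S <-]; apply: DB.
pose r := sup A.
have Dr S : (S0 `<=` S)%fset -> D S <= r.
  by move=> S0S; apply: ub_le_sup; [exact: supA.2|exists S].
have rD eps : 0 < eps -> exists2 S1, (S0 `<=` S1)%fset &
    forall S, (S1 `<=` S)%fset -> r - eps < D S.
  move=> eps0; have [_ [S1 S01 <-] rS1] := sup_adherent eps0 supA.
  by exists S1 => // S S1S; apply: lt_le_trans rS1 _; apply: Dmono.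
pose delta S := Num.sqrt (r - D S).
have Jdelta S T f : (S0 `<=` S)%fset -> (S `<=` T)%fset ->
    `|J S f - J T f| <= delta S.
  move=> S0S ST; have S0T := fsubset_trans S0S ST.
  rewrite -sqrtr_sqr ler_wsqrtr//; have := JD _ _ [fset f]%fset S0S ST.
  rewrite big_seq_fset1 => /le_trans; apply; rewrite lerD2r; exact: Dr.
have Jcross S T f : (S0 `<=` S)%fset -> (S0 `<=` T)%fset ->
    J S f - delta S <= J T f + delta T.
  move=> S0S S0T.
  have := Jdelta _ _ f S0S (fsubsetUl S T).
  have := Jdelta _ _ f S0T (fsubsetUr S T).
  rewrite !ler_norml => /andP[h1 h2] /andP[h3 h4]; lra.
pose Lo f := [set J S f - delta S | S in [set S | (S0 `<=` S)%fset]].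
pose i f := sup (Lo f).
have Ji S f : (S0 `<=` S)%fset -> `|J S f - i f| <= delta S.
  move=> S0S; rewrite ler_norml; apply/andP; split.
    rewrite lerBrDr addrC -lerBrDr opprK; apply: ge_sup; first by
      exists (J S0 f - delta S0), S0; rewrite /= ?fsubset_refl.
    by move=> _ [T S0T <-]; apply: Jcross.
  rewrite lerBlDr addrC -lerBlDr; apply: ub_le_sup; last by exists S.
  exists (J S0 f + delta S0) => _ [T S0T <-].
  by apply: Jcross; rewrite /= ?fsubset_refl.
exists i, r; split=> // S F S0S.
apply: le_of_almost => [|t t0]; first by rewrite subr_ge0 Dr.
exists (1 + t^-1) => [|eps eps0]; first by rewrite ltr_wpDr ?invr_ge0 ?ltW.
have n0 : 0 < (size F).+1%:R :> R by rewrite ltr0n.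
have [S1 S01 rS1] := rD _ (divr_gt0 eps0 n0).
pose T := (S `|` S1)%fset; have S0T : (S0 `<=` T)%fset.
  by apply: fsubset_trans S0S _; apply: fsubsetUl.
have rT := rS1 T (fsubsetUr _ _).
have -> : \sum_(f <- F) (J S f - i f) ^+ 2 =
    \sum_(f <- F) ((J S f - J T f) + (J T f - i f)) ^+ 2.
  by apply: eq_bigr => f _; rewrite subrKA.
apply: le_trans (sum_sqrD_le F _ _ t0) _; apply: lerD.
  apply: ler_wpM2l; first by rewrite addr_ge0 ?ltW.
  by apply: le_trans (JD S T F S0S (fsubsetUl _ _)) _; rewrite lerD2r Dr.
apply: ler_wpM2l; first by rewrite addr_ge0 ?invr_ge0 ?ltW.
have le1 f : (J T f - i f) ^+ 2 <= eps / (size F).+1%:R.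
  rewrite -real_normK ?num_real// (@le_trans _ _ (delta T ^+ 2))//.
    by rewrite ler_pXn2r ?nnegrE ?sqrtr_ge0// Ji.
  by rewrite sqr_sqrtr ?subr_ge0 ?Dr// lerBlDr -lerBlDl ltW.
apply: le_trans (ler_sum _ (fun f _ => le1 f)) _.
rewrite big_const_seq count_predT iter_addr addr0.
by rewrite -[_ *+ size F]mulr_natr -mulrA ger_pMr// mulrC ler_pdivrMr// mul1r ler_nat.
Qed.

Lemma cvg0_fin_ge0 (R : realType) (u : nat -> \bar R) :
  (forall n, 0 <= u n)%E ->
  u n @[n --> \oo] --> 0%E <->
  forall eps : R, 0 < eps -> \forall n \near \oo, (u n <= eps%:E)%E.
Proof.
move=> u0; split=> [/fine_cvgP[ufin /cvgr0Pnorm_le uc] eps eps0|h].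
  near=> n; rewrite -(@fineK _ (u n)); last by near: n.
  rewrite lee_fin (le_trans (ler_norm _))//; near: n; exact: uc.
have ufin eps n : (u n <= eps%:E)%E -> u n \is a fin_num.
  by move=> un; rewrite ge0_fin_numE// (le_lt_trans un) ?ltry.
apply/fine_cvgP; split.
  by apply: filterS (h 1 ltr01) => n; apply: ufin.
apply/cvgr0Pnorm_le => eps eps0; apply: filterS (h eps eps0) => n un /=.
by rewrite ger0_norm ?fine_ge0// -lee_fin fineK// (ufin eps).
Unshelve. all: by end_near. Qed.

Section LimitCurrent.
Context (R : realType) (G : multigraph).
Variables (current : {fset vertex G} -> flow R G -> Prop)
  (J : {fset vertex G} -> flow R G) (D : {fset vertex G} -> R)
  (a B : R) (S0 : {fset vertex G}).
Hypothesis currentJ : forall S i, (S0 `<=` S)%fset -> current S i <-> i = J S.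
Hypothesis JD : forall S T (F : {fset edge G}),
  (S0 `<=` S)%fset -> (S `<=` T)%fset ->
  \sum_(f <- F) (J S f - J T f) ^+ 2 <= D T - D S.
Hypothesis DB : forall S, (S0 `<=` S)%fset -> D S <= B.
Hypothesis JE : forall S, (S0 `<=` S)%fset -> energy (J S) = (a * D S)%:E.
Hypothesis a1 : `|a| <= 1.

(** The currents being unique, both limits are approached by the same ones. *)
Lemma limit_current_unique (T : nat -> {fset vertex G}) (i i' : flow R G) :
  swelling T -> is_limit_current current i -> is_limit_current current i' ->
  i = i'.
Proof.
move=> Tsw iL iL'.
have [j [jT ji]] := iL T Tsw; have [j' [jT' ji']] := iL' T Tsw.
move/(cvg0_fin_ge0 (fun n => energy_ge0 _)) : ji => ji.
move/(cvg0_fin_ge0 (fun n => energy_ge0 _)) : ji' => ji'.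
apply/funext => e; apply/eqP; rewrite -subr_eq0 -sqrf_eq0 eq_le sqr_ge0 andbT.
apply/ler_addgt0Pr => eps eps0; rewrite add0r.
have eps4 : 0 < eps / 4 by rewrite divr_gt0.
near \oo => n.
have S0T : (S0 `<=` T n)%fset by near: n; apply: Tsw.
have jE : j n = J (T n) by apply/currentJ => //; near: n.
have jE' : j' n = J (T n) by apply/currentJ => //; near: n.
have h1 : (energy (fun e => (j n e - i e)%R) <= (eps / 4)%:E)%E by near: n; apply: ji.
have h2 : (energy (fun e => (j' n e - i' e)%R) <= (eps / 4)%:E)%E by near: n; apply: ji'.
have := le_trans (energy_ge [fset e]%fset _) h1.
have := le_trans (energy_ge [fset e]%fset _) h2.
rewrite !big_seq_fset1 !lee_fin jE jE' => k1 k2.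
have -> : i e - i' e = (J (T n) e - i' e) + - (J (T n) e - i e) by ring.
by apply: le_trans (sqrD_le _ _ ltr01) _; rewrite invr1 sqrrN; lra.
Unshelve. all: by end_near. Qed.

(** In the applications [a] is 1 or -1: cut resistances decrease and shorted ones
increase, and [D] is the resistance up to the sign that makes it increase. *)
Lemma limit_current_energy (T : nat -> {fset vertex G}) : swelling T ->
  exists r, [/\ forall S, (S0 `<=` S)%fset -> D S <= r,
    forall eps, 0 < eps ->
      exists2 S1, (S0 `<=` S1)%fset & r - eps < D S1 &
    energy (xget (fun=> 0) [set i | is_limit_current current i]) =
      (a * r)%:E].
Proof.
move=> Tsw; have [i [r [Dr rD iJ]]] := monotone_net_limit JD DB.
exists r; split=> // [eps /rD[S1 S01 rS1]|].
  by exists S1 => //; apply: rS1; apply: fsubset_refl.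
have iL : is_limit_current current i.
  move=> U Usw; exists (fun n => J (U n)); split.
    by near=> n; apply/currentJ => //; near: n; apply: Usw.
  apply/(cvg0_fin_ge0 (fun n => energy_ge0 _)) => eps eps0.
  have [S1 S01 rS1] := rD _ eps0.
  near=> n; have S1U : (S1 `<=` U n)%fset by near: n; apply: Usw.
  apply: energy_le => F; apply: le_trans (iJ _ F (fsubset_trans S01 S1U)) _.
  by rewrite lerBlDr -lerBlDl ltW// rS1.
have -> : xget (fun=> 0) [set i | is_limit_current current i] = i.
  by apply: (limit_current_unique Tsw) => //; exact: (xgetI _ iL).
have aDr S : (S0 `<=` S)%fset -> `|a * D S - a * r| <= r - D S.
  move=> S0S; rewrite -mulrBr normrM distrC (ger0_norm (x := r - _)) ?subr_ge0 ?Dr//.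
  by rewrite ler_piMl// subr_ge0 Dr.
have JF S (F : {fset edge G}) : (S0 `<=` S)%fset -> \sum_(f <- F) J S f ^+ 2 <= a * D S.
  by move=> S0S; rewrite -lee_fin -JE//; apply: energy_ge.
have ar0 : 0 <= a * r.
  apply/ler_addgt0Pr => eps /rD[S1 S01 rS1].
  have := JF S1 fset0 S01; rewrite big_seq_fset0.
  have := aDr _ S01; rewrite ler_norml => /andP[h1 h2].
  have := rS1 _ (fsubset_refl _); lra.
have iF (F : {fset edge G}) : \sum_(f <- F) i f ^+ 2 <= a * r.
  apply: le_of_almost => // t t0.
  have t1 : 0 < t^-1 by rewrite invr_gt0.
  exists ((1 + t) + (1 + t^-1)) => [|eps /rD[S1 S01 rS1]]; first by rewrite !addr_gt0.
  have -> : \sum_(f <- F) i f ^+ 2 =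
      \sum_(f <- F) (J S1 f + (i f - J S1 f)) ^+ 2.
    by apply: eq_bigr => f _; congr (_ ^+ 2); ring.
  apply: le_trans (sum_sqrD_le F _ _ t0) _.
  have h1 := JF S1 F S01.
  have h2 : \sum_(f <- F) (i f - J S1 f) ^+ 2 <= r - D S1.
    apply: le_trans (iJ S1 F S01); apply: ler_sum => f _.
    by rewrite -sqrrN opprB.
  have := aDr _ S01; rewrite ler_norml => /andP[h3 h4].
  have h5 := rS1 _ (fsubset_refl _).
  have h6 : \sum_(f <- F) (i f - J S1 f) ^+ 2 <= eps by lra.
  have h7 : \sum_(f <- F) J S1 f ^+ 2 <= a * r + eps by lra.
  have := ler_wpM2l (ltW (addr_gt0 ltr01 t0)) h7.
  have := ler_wpM2l (ltW (addr_gt0 ltr01 t1)) h6.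
  lra.
apply/eqP; rewrite eq_le energy_le//=.
have ifin : energy i \is a fin_num.
  by rewrite ge0_fin_numE ?energy_ge0// (le_lt_trans (energy_le iF)) ?ltry.
rewrite -(fineK ifin) lee_fin; apply: le_of_almost => [|t t0].
  exact/fine_ge0/energy_ge0.
have t1 : 0 < t^-1 by rewrite invr_gt0.
exists (1 + (1 + t^-1)) => [|eps /rD[S1 S01 rS1]]; first by rewrite !addr_gt0.
have h5 := rS1 _ (fsubset_refl _).
have := aDr _ S01; rewrite ler_norml => /andP[h3 h4].
suff : a * D S1 <= (1 + t) * fine (energy i) + (1 + t^-1) * eps by lra.
rewrite -lee_fin -JE//; apply: energy_le => F.
have -> : \sum_(f <- F) J S1 f ^+ 2 =
    \sum_(f <- F) (i f + (J S1 f - i f)) ^+ 2.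
  by apply: eq_bigr => f _; congr (_ ^+ 2); ring.
apply: le_trans (sum_sqrD_le F _ _ t0) _; apply: lerD; apply: ler_wpM2l.
- by rewrite addr_ge0 ?ltW.
- by rewrite -lee_fin fineK// energy_ge.
- by rewrite addr_ge0 ?ltW.
- by have := iJ S1 F S01; lra.
Unshelve. all: by end_near. Qed.
End LimitCurrent.

(** * Even and odd resistances *)

Section Resistances.
Context (R : realType) (G : multigraph).
Hypotheses (Glf : locally_finite_graph G) (Gconn : connected_graph G)
  (Ginf : infinite_graph G).
Variable T0 : nat -> {fset vertex G}.
Hypothesis T0sw : swelling T0.
Implicit Types (S T : {fset vertex G}) (e : edge G) (i : flow R G).

Lemma inside_endpoints S e :
  ([fset source e; target e] `<=` S)%fset = inside S e.
Proof. by rewrite fsubUset !fsub1set. Qed.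

Lemma cut_exists S e : inside S e -> exists i : flow R G, weak_cut_current S e i.
Proof. by have [J [JS _]] := cut_foster R Glf S => /JS; exists (J e). Qed.

Lemma short_exists S e : inside S e -> exists i : flow R G, weak_short_current S e i.
Proof.
have [J [JS _]] := short_foster R Glf Gconn Ginf S => eS.
by exists (J e); apply: JS; rewrite in_touching// inside_touches.
Qed.

Lemma cut_sum_sqr S e i (F : {fset edge G}) : weak_cut_current S e i ->
  \sum_(f <- F) i f ^+ 2 <= i e.
Proof.
move=> iS; rewrite -(cut_energy Glf iS (fsubsetUr F (touching S))).
by apply: ler_sum_fset => [|f]; [apply: fsubsetUl|apply: sqr_ge0].
Qed.

Lemma short_sum_sqr S e i (F : {fset edge G}) : weak_short_current S e i ->
  \sum_(f <- F) i f ^+ 2 <= i e.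
Proof.
move=> iS; rewrite -(short_energy Glf iS (fsubsetUr F (touching S))).
by apply: ler_sum_fset => [|f]; [apply: fsubsetUl|apply: sqr_ge0].
Qed.

(** [limit_current_energy] with [a = -1]. The two parts together make the even
resistance the infimum of the cut resistances. *)
Lemma even_resistanceP e (r := even_resistance R (source e) (target e)) :
  (forall S i, weak_cut_current S e i -> r <= i e) /\
  (forall eps, 0 < eps -> exists S i, weak_cut_current S e i /\ i e < r + eps).
Proof.
pose J S : flow R G := xget (fun=> 0) [set i | weak_cut_current S e i].
have Jspec S : inside S e -> weak_cut_current S e (J S).
  by move=> /cut_exists[i iS]; rewrite /J; apply: (xgetI _ iS).
have Ju S i : weak_cut_current S e i -> i = J S.
  by move=> iS; have [eS _ _ _] := iS; apply: (cut_unique Glf iS (Jspec _ eS)).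
have [|S T F|S|S||s [Ds sD eflow]] := @limit_current_energy R G
  (fun S => cut_current S (source e) (target e)) J (fun S => - J S e) (-1) 0
  [fset source e; target e]%fset _ _ _ _ _ T0 T0sw.
- move=> S i; rewrite inside_endpoints => eS; rewrite cut_currentP//.
  by split=> [/Ju//|->]; apply: Jspec.
- rewrite inside_endpoints => eS ST; rewrite opprK addrC.
  exact: (cut_diff Glf F (Jspec _ eS) (Jspec _ (inside_sub ST eS)) ST).
- by rewrite inside_endpoints oppr_le0 => eS; apply: (cut_ge0 Glf) (Jspec _ eS).
- rewrite inside_endpoints => eS; rewrite mulN1r opprK; apply/eqP.
  rewrite eq_le energy_le => [|F]; last exact: cut_sum_sqr (Jspec _ eS).
  rewrite -{1}(cut_energy Glf (Jspec _ eS) (fsubset_refl _)).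
  exact: energy_ge.
- by rewrite normrN1.
have -> : r = - s by rewrite /r /even_resistance /even_flow eflow /= mulN1r.
split=> [S i iS|eps /sD[S]].
  rewrite (Ju _ _ iS) lerNl; apply: Ds; rewrite inside_endpoints.
  by case: iS.
rewrite inside_endpoints => eS sS; exists S, (J S); split; first exact: Jspec.
lra.
Qed.

(** [limit_current_energy] with [a = 1]. The two parts together make the odd
resistance the supremum of the shorted resistances. *)
Lemma odd_resistanceP e (r := odd_resistance R (source e) (target e)) :
  (forall S i, inside S e -> weak_short_current S e i -> i e <= r) /\
  (forall eps, 0 < eps ->
    exists S i, [/\ inside S e, weak_short_current S e i & r - eps < i e]).
Proof.
pose J S : flow R G := xget (fun=> 0) [set i | weak_short_current S e i].
have Jspec S : inside S e -> weak_short_current S e (J S).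
  by move=> /short_exists[i iS]; rewrite /J; apply: (xgetI _ iS).
have Ju S i : inside S e -> weak_short_current S e i -> i = J S.
  by move=> eS iS; apply: (short_unique Glf iS (Jspec _ eS)).
have [|S T F|S|S||s [Ds sD oflow]] := @limit_current_energy R G
  (fun S => short_current S (source e) (target e)) J (fun S => J S e) 1 1
  [fset source e; target e]%fset _ _ _ _ _ T0 T0sw.
- move=> S i; rewrite inside_endpoints => eS; rewrite short_currentP//.
  by split=> [/Ju->//|->]; apply: Jspec.
- rewrite inside_endpoints => eS ST.
  exact: (short_diff Glf F (Jspec _ eS) (Jspec _ (inside_sub ST eS)) ST).
- by rewrite inside_endpoints => eS; apply: (short_le1 Glf) (Jspec _ eS).
- rewrite inside_endpoints => eS; rewrite mul1r; apply/eqP.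
  rewrite eq_le energy_le => [|F]; last exact: short_sum_sqr (Jspec _ eS).
  rewrite -{1}(short_energy Glf (Jspec _ eS) (fsubset_refl _)).
  exact: energy_ge.
- by rewrite normr1.
have -> : r = s by rewrite /r /odd_resistance /odd_flow oflow /= mul1r.
split=> [S i eS iS|eps /sD[S]].
  by rewrite (Ju _ _ eS iS); apply: Ds; rewrite inside_endpoints.
by rewrite inside_endpoints => eS sS; exists S, (J S); split=> //; exact: Jspec.
Qed.

Lemma odd_le_even e :
  odd_resistance R (source e) (target e) <= even_resistance R (source e) (target e).
Proof.
have [_ oP] := odd_resistanceP e; have [_ eP] := even_resistanceP e.
apply/ler_addgt0Pr => eps eps0; have eps2 : 0 < eps / 2 by rewrite divr_gt0.
have [S [i [eS iS ri]]] := oP _ eps2; have [T [j [jT jr]]] := eP _ eps2.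
have := short_le_cut Glf iS jT; lra.
Qed.

Lemma sum_even_le S :
  \sum_(e <- touching S | inside S e)
     even_resistance R (source e) (target e) <= #|` S|%:R.
Proof.
have [J [JS Jsum]] := cut_foster R Glf S; apply: le_trans Jsum.
by apply: ler_sum => e /JS; apply: (even_resistanceP e).1.
Qed.

(** Foster's identity counts the edges of the boundary too; the shorted resistance
across each of them is at most 1. *)
Lemma sum_odd_ge S :
  #|` S|%:R - \sum_(e <- touching S | ~~ inside S e) 1 <=
  \sum_(e <- touching S | inside S e)
     odd_resistance R (source e) (target e).
Proof.
have [J [JS Jsum]] := short_foster R Glf Gconn Ginf S.
rewrite -Jsum (bigID (inside S)) /= -addrA -[leRHS]addr0; apply: lerD.
  apply: ler_sum => e eS; apply: (odd_resistanceP e).1 (eS) _; apply: JS.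
  by rewrite in_touching// inside_touches.
rewrite subr_le0 big_seq_cond [leRHS]big_seq_cond.
by apply: ler_sum => e /andP[/JS/(short_le1 Glf)].
Qed.

Lemma automorphism_inv (f : vertex G -> vertex G) (g : edge G -> edge G) :
  automorphism f g -> exists f' g',
    [/\ automorphism f' g', cancel f f', cancel f' f, cancel g g' & cancel g' g].
Proof.
case=> -[f' fK f'K] [g' gK g'K] fg; exists f', g'; split=> //; split.
- by exists f.
- by exists g.
move=> e; have := fg (g' e); rewrite g'K => -[[-> ->]|[-> ->]]; rewrite !fK; first by left.
by right.
Qed.

(** Expansion of the squared length of [i - s * k]. It bounds the energy [c] of a
gradient by that of a flow [i] whose pairing with it is [c] up to sign. *)
Lemma projection_le (F : {fset edge G}) (x s d c : R) (i k : edge G -> R) :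
    s ^+ 2 = 1 -> \sum_(h <- F) i h ^+ 2 <= x -> \sum_(h <- F) k h ^+ 2 <= c ->
    \sum_(h <- F) i h * k h = d -> s * d = c ->
  c <= x.
Proof.
move=> s1 ix kc ikd sdc.
have : 0 <= \sum_(h <- F) (i h - s * k h) ^+ 2 by apply: sumr_ge0 => h _; apply: sqr_ge0.
have -> : \sum_(h <- F) (i h - s * k h) ^+ 2 =
    \sum_(h <- F) i h ^+ 2 - 2 * (s * \sum_(h <- F) i h * k h) +
    s ^+ 2 * \sum_(h <- F) k h ^+ 2.
  rewrite !big_distrr /= -sumrB -big_split; apply: eq_bigr => h _ /=; ring.
rewrite ikd s1 sdc mul1r; lra.
Qed.

Section Automorphism.
Variables (f : vertex G -> vertex G) (g : edge G -> edge G).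
Hypothesis fg : automorphism f g.
Variables (S S' : {fset vertex G}).
Hypothesis SS' : forall v, (f v \in S') = (v \in S).

Lemma inside_auto e : inside S' (g e) = inside S e.
Proof.
rewrite /inside; case: fg => _ _ /(_ e)[][-> ->]; rewrite !SS'//.
by rewrite andbC.
Qed.

Lemma gradient_auto (psi : vertex G -> R) e :
  gradient psi (g e) = gradient (psi \o f) e \/
  gradient psi (g e) = - gradient (psi \o f) e.
Proof.
case: fg => _ _ /(_ e)[][se te]; rewrite /gradient se te; [left|right] => //=.
by rewrite opprB.
Qed.

Lemma sqr_gradient_auto (psi : vertex G -> R) e :
  gradient (psi \o f) e ^+ 2 = gradient psi (g e) ^+ 2.
Proof. by case: (gradient_auto psi e) => ->; rewrite ?sqrrN. Qed.

Lemma sign_gradient_auto (psi : vertex G -> R) e : exists2 s : R,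
  s ^+ 2 = 1 & s * gradient (psi \o f) e = gradient psi (g e).
Proof.
case: (gradient_auto psi e) => ->; first by exists 1; rewrite ?expr1n ?mul1r.
by exists (-1); rewrite ?sqrrN ?expr1n ?mulN1r.
Qed.

Lemma sum_sqr_auto (F : {fset edge G}) (h : edge G -> R) :
  \sum_(e <- F) h (g e) ^+ 2 = \sum_(e <- [fset g e | e in F]%fset) h e ^+ 2.
Proof.
by rewrite big_imfset //= => x y _ _; case: fg => _ /bij_inj gi _ /gi.
Qed.

(** An automorphism reverses edges arbitrarily with respect to the reference
orientation, so currents are not transported; instead the potential of [i'] is
pulled back, and only the squares of its gradient matter. *)
Lemma cut_auto e i i' : weak_cut_current S e i -> weak_cut_current S' (g e) i' ->
  i' (g e) <= i e.
Proof.
move=> iS iS'; have [eS i0 _ istr] := iS; have [_ i'0 [phi i'phi] _] := iS'.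
(* The potential of [i'] is only meaningful inside [S']. *)
pose k h := if inside S h then gradient (phi \o f) h else 0.
have [s s1 sE] := sign_gradient_auto phi e.
apply: (@projection_le (touching S) (i e) s (gradient (phi \o f) e) _ i k) => //.
- exact: (cut_sum_sqr (touching S) iS).
- have kE h : k h ^+ 2 = i' (g h) ^+ 2.
    rewrite /k; case: ifPn => hS; last by rewrite i'0 ?inside_auto// !expr0n.
    by rewrite i'phi ?inside_auto// sqr_gradient_auto.
  under eq_bigr do rewrite kE.
  by rewrite sum_sqr_auto; apply: cut_sum_sqr iS'.
- rewrite -istr; apply: eq_bigr => h _; rewrite /k.
  by case: ifPn => // /i0 ->; rewrite !mul0r.
- by rewrite sE i'phi// inside_auto.
Qed.

Lemma short_auto e i i' : weak_short_current S e i -> weak_short_current S' (g e) i' ->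
  i' (g e) <= i e.
Proof.
move=> iS iS'; have [_ istr] := iS; have [[phi phi0 i'phi] _] := iS'.
have [s s1 sE] := sign_gradient_auto phi e.
apply: (@projection_le (touching S) (i e) s (gradient (phi \o f) e) _ i
  (gradient (phi \o f))) => //.
- exact: (short_sum_sqr (touching S) iS).
- have kE h : gradient (phi \o f) h ^+ 2 = i' (g h) ^+ 2.
    by rewrite sqr_gradient_auto i'phi.
  under eq_bigr do rewrite kE.
  by rewrite sum_sqr_auto; apply: short_sum_sqr iS'.
- by apply: istr => v vS; apply: phi0; rewrite SS'.
- by rewrite sE i'phi.
Qed.
End Automorphism.

Lemma even_auto_le f g e : @automorphism G f g ->
  even_resistance R (source (g e)) (target (g e)) <=
  even_resistance R (source e) (target e).
Proof.
move=> fg; have [/bij_inj finj _ _] := fg.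
have [_ eP] := even_resistanceP e; have [geP _] := even_resistanceP (g e).
apply/ler_addgt0Pr => eps /eP[S [i [iS /ltW ie]]]; apply: le_trans ie.
have SS' v : (f v \in [fset f x | x in S]%fset) = (v \in S) by rewrite mem_imfset.
have [eS _ _ _] := iS.
have [|i' iS'] := @cut_exists [fset f x | x in S]%fset (g e).
  by rewrite (inside_auto fg SS').
apply: le_trans (geP _ _ iS') _; exact: (cut_auto fg SS' iS iS').
Qed.

Lemma odd_auto_le f g e : @automorphism G f g ->
  odd_resistance R (source (g e)) (target (g e)) <=
  odd_resistance R (source e) (target e).
Proof.
move=> fg; have [f' [g' [_ fK f'K _ _]]] := automorphism_inv fg.
have [eP _] := odd_resistanceP e; have [_ geP] := odd_resistanceP (g e).
apply/ler_addgt0Pr => eps /geP[S' [i' [geS' iS']]].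
rewrite ltrBlDr => /ltW/le_trans; apply; rewrite lerD2r.
have SS' v : (f v \in S') = (v \in [fset f' x | x in S']%fset).
  by rewrite -{2}[v]fK mem_imfset//; apply: can_inj f'K.
have eS : inside [fset f' x | x in S']%fset e by rewrite -(inside_auto fg SS').
have [i iS] := short_exists eS.
apply: le_trans (eP _ _ eS iS); exact: (short_auto fg SS' iS iS').
Qed.

Lemma even_auto f g e : @automorphism G f g ->
  even_resistance R (source (g e)) (target (g e)) =
  even_resistance R (source e) (target e).
Proof.
move=> fg; have [f' [g' [fg' _ _ gK _]]] := automorphism_inv fg.
apply/eqP; rewrite eq_le (@even_auto_le f g e fg)/=.
by have := @even_auto_le f' g' (g e) fg'; rewrite gK.
Qed.

Lemma odd_auto f g e : @automorphism G f g ->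
  odd_resistance R (source (g e)) (target (g e)) =
  odd_resistance R (source e) (target e).
Proof.
move=> fg; have [f' [g' [fg' _ _ gK _]]] := automorphism_inv fg.
apply/eqP; rewrite eq_le (@odd_auto_le f g e fg)/=.
by have := @odd_auto_le f' g' (g e) fg'; rewrite gK.
Qed.
End Resistances.

(** * Kinds of vertices and edges *)

Section Kinds.
Variable G : multigraph.

Lemma automorphism_id : @automorphism G id id.
Proof. by split; [exists id|exists id|left]. Qed.

Lemma automorphism_comp f1 g1 f2 g2 : @automorphism G f1 g1 ->
  @automorphism G f2 g2 -> @automorphism G (f2 \o f1) (g2 \o g1).
Proof.
move=> [f1b g1b fg1] [f2b g2b fg2]; split; [exact: bij_comp|exact: bij_comp|].
move=> e /=; case: (fg2 (g1 e)) (fg1 e) => [][-> ->] [][-> ->]; auto.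
Qed.

Lemma vertex_kind_refl (v : vertex G) : vertex_kind v v.
Proof. by exists id, id; split=> //; apply: automorphism_id. Qed.

Lemma edge_kind_refl (e : edge G) : edge_kind e e.
Proof. by exists id, id; split=> //; apply: automorphism_id. Qed.

Lemma vertex_kind_eq (v w : vertex G) :
  vertex_kind v w -> vertex_kind v = vertex_kind w.
Proof.
case=> f [g [fg <-]]; have [f' [g' [fg' fK f'K _ _]]] := automorphism_inv fg.
apply/seteqP; split=> _ [f2 [g2 [fg2 <-]]].
  exists (f2 \o f'), (g2 \o g'); split; first exact: automorphism_comp.
  by rewrite /= fK.
by exists (f2 \o f), (g2 \o g); split=> //; exact: automorphism_comp.
Qed.

Lemma edge_kind_eq (e d : edge G) : edge_kind e d -> edge_kind e = edge_kind d.
Proof.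
case=> f [g [fg <-]]; have [f' [g' [fg' _ _ gK g'K]]] := automorphism_inv fg.
apply/seteqP; split=> _ [f2 [g2 [fg2 <-]]].
  exists (f2 \o f'), (g2 \o g'); split; first exact: automorphism_comp.
  by rewrite /= gK.
by exists (f2 \o f), (g2 \o g); split=> //; exact: automorphism_comp.
Qed.

Lemma vertex_kind_auto f g (v : vertex G) : @automorphism G f g ->
  vertex_kind (f v) = vertex_kind v.
Proof. by move=> fg; apply/esym/vertex_kind_eq; exists f, g. Qed.

Lemma edge_kind_auto f g (e : edge G) : @automorphism G f g ->
  edge_kind (g e) = edge_kind e.
Proof. by move=> fg; apply/esym/edge_kind_eq; exists f, g. Qed.

Lemma mem_vertex_kinds K (v : vertex G) : vertex_kinds K ->
  (v \in K) = (K == vertex_kind v).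
Proof.
case=> w _ <-; apply/idP/eqP => [|->]; first by rewrite inE => /vertex_kind_eq.
by rewrite inE; apply: vertex_kind_refl.
Qed.

Lemma mem_edge_kinds K (e : edge G) : edge_kinds K ->
  (e \in K) = (K == edge_kind e).
Proof.
case=> w _ <-; apply/idP/eqP => [|->]; first by rewrite inE => /edge_kind_eq.
by rewrite inE; apply: edge_kind_refl.
Qed.

Lemma incident_auto f g v e : @automorphism G f g ->
  incident_edges (f v) (g e) <-> incident_edges v e.
Proof.
move=> fg; have [/bij_inj fi _ /(_ e)] := fg; rewrite /incident_edges /=.
by case=> -[-> ->]; split=> -[E|E]; first
  [by left; apply: fi | by right; apply: fi | by left; rewrite E
  |by right; rewrite E].
Qed.

Hypothesis Glf : locally_finite_graph G.

Lemma finite_edge_kinds : symmetrical G -> finite_set (@edge_kinds G).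
Proof.
move=> Gsym.
apply: (@sub_finite_set _ _ (\bigcup_(K in @vertex_kinds G)
    [set edge_kind e | e in [set e | exists2 v, K v & incident_edges v e]])).
  move=> _ [e _ <-]; exists (vertex_kind (source e)); first by exists (source e).
  by exists e => //; exists (source e); [exact: vertex_kind_refl|left].
apply: bigcup_finite => // _ [v _ <-].
apply: sub_finite_set (finite_image (@edge_kind G) (Glf v)).
move=> _ [e [_ [f [g [fg <-]]] ev] <-].
have [f' [g' [fg' _ _ _ g'K]]] := automorphism_inv fg.
exists (g' e); last by rewrite (edge_kind_auto _ fg').
by apply/(incident_auto _ _ fg); rewrite g'K.
Qed.

Definition star (v : vertex G) : {fset edge G} := fset_set (incident_edges v).

Lemma in_star v e : (e \in star v) = (source e == v) || (target e == v).
Proof.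
rewrite in_fset_set//; apply/idP/idP; rewrite inE.
  by case=> ->; rewrite eqxx ?orbT.
by case/orP=> /eqP; [left|right].
Qed.

Variable R : realType.

Lemma sum_star_auto f g v (k : edge G -> R) : @automorphism G f g ->
  \sum_(e <- star (f v)) k e = \sum_(e <- star v) k (g e).
Proof.
move=> fg; have [_ gb _] := fg.
transitivity (\sum_(e <- [fset g e | e in star v]%fset) k e); last first.
  by rewrite big_imfset //= => x y _ _; apply: bij_inj.
congr (\sum_(e <- enum_fset _) _); apply/fsetP => e.
have [f' [g' [fg' _ _ _ g'K]]] := automorphism_inv fg.
rewrite -[e]g'K mem_imfset; last exact: bij_inj.
rewrite /star !in_fset_set//.
by apply/idP/idP; rewrite !inE => /(incident_auto _ _ fg).
Qed.

Hypothesis Gloopless : loopless G.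

Definition boundary_size (T : {fset vertex G}) : R :=
  \sum_(e <- touching T | ~~ inside T e) 1.

(** An edge inside [T] is counted at both ends and an edge of the boundary once;
loops would spoil the count. *)
Lemma handshake (T : {fset vertex G}) (h : vertex G -> edge G -> R) :
  \sum_(v <- T) \sum_(e <- star v) h v e =
  \sum_(e <- touching T | inside T e) (h (source e) e + h (target e) e) +
  \sum_(e <- touching T | ~~ inside T e)
     (if source e \in T then h (source e) e else h (target e) e).
Proof.
have pick (u : vertex G) e :
    \sum_(v <- T) (u == v)%:R * h v e = (u \in T)%:R * h u e.
  have [uT|uT] := boolP (u \in T).
    rewrite (big_fsetD1 u)//= eqxx big1_seq ?addr0// => v /=.
    by rewrite !inE => /andP[/negbTE vu _]; rewrite eq_sym vu mul0r.
  rewrite mul0r big1_seq// => v /= vT; case: eqP => [uv|]; last by rewrite mul0r.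
  by rewrite uv vT in uT.
transitivity (\sum_(v <- T) \sum_(e <- touching T)
    ((source e == v)%:R * h v e + (target e == v)%:R * h v e)).
  rewrite big_seq [RHS]big_seq; apply: eq_bigr => v vT.
  rewrite [RHS](@sum_superset _ _ (star v)) => [||e].
  - apply: eq_big_seq => e; rewrite in_star => /orP[]/eqP<-.
      rewrite eqxx (_ : _ == _ = false) ?mul1r ?mul0r ?addr0//.
      by apply/eqP => /esym; apply: Gloopless.
    rewrite eqxx (_ : _ == _ = false) ?mul1r ?mul0r ?add0r//.
    by apply/eqP; apply: Gloopless.
  - apply/fsubsetP => e; rewrite in_star in_touching//.
    by rewrite /touches => /orP[]/eqP->; rewrite vT ?orbT.
  - by rewrite in_star negb_or => /andP[/negbTE-> /negbTE->]; rewrite !mul0r addr0.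
rewrite exchange_big (bigID (inside T)) /=; congr (_ + _).
  apply: eq_bigr => e /andP[sT tT].
  by rewrite big_split /= !pick sT tT !mul1r.
rewrite big_seq_cond [RHS]big_seq_cond; apply: eq_bigr => e /andP[].
rewrite in_touching// /touches /inside big_split /= !pick.
by do 2![case: (_ \in T) => //=]; rewrite ?mul1r ?mul0r ?addr0 ?add0r.
Qed.

Definition count_in (T : {fset vertex G}) (K : set (vertex G)) : R :=
  \sum_(v <- T) (v \in K)%:R.

Definition other (e : edge G) (v : vertex G) :=
  if source e == v then target e else source e.

Lemma other_source e : other e (source e) = target e.
Proof. by rewrite /other eqxx. Qed.

Lemma other_target e : other e (target e) = source e.
Proof. by rewrite /other; case: eqP. Qed.

Lemma other_auto f g v e : @automorphism G f g -> e \in star v ->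
  other (g e) (f v) = f (other e v).
Proof.
move=> fg; have [/bij_inj fi _ /(_ e)] := fg; rewrite in_star => gse.
by case/orP => /eqP <-; rewrite ?other_source ?other_target;
  case: gse => -[<- <-]; rewrite ?other_source ?other_target.
Qed.

Definition kind_valence (v : vertex G) (L : set (vertex G)) : R :=
  \sum_(e <- star v) (other e v \in L)%:R.

Lemma kind_valence_auto f g v L : @automorphism G f g -> vertex_kinds L ->
  kind_valence (f v) L = kind_valence v L.
Proof.
move=> fg LK; rewrite /kind_valence (sum_star_auto _ _ fg).
apply: eq_big_seq => e ev; rewrite (other_auto fg)//.
by rewrite !mem_vertex_kinds// (vertex_kind_auto _ fg).
Qed.

(** All vertices of a kind have the same number of neighbours of kind [L], counted
with multiplicity. *)
Lemma kind_valence_count (T : {fset vertex G}) u L : vertex_kinds L ->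
  \sum_(v <- T) \sum_(e <- star v)
    ((v \in vertex_kind u)%:R * (other e v \in L)%:R) =
  kind_valence u L * count_in T (vertex_kind u).
Proof.
move=> LK; rewrite /count_in big_distrr /=; apply: eq_bigr => v _.
rewrite -big_distrr /= mulrC -/(kind_valence v L).
have [|_] := boolP (v \in _); last by rewrite !mulr0.
by rewrite inE => -[f [g [fg <-]]]; rewrite (kind_valence_auto _ fg).
Qed.

(** Both products count the edges between the two kinds that have an end in [T],
from one kind or from the other. They can differ only on the boundary. *)
Lemma edge_count_balance T u w :
  `|kind_valence u (vertex_kind w) * count_in T (vertex_kind u) -
    kind_valence w (vertex_kind u) * count_in T (vertex_kind w)| <=
  boundary_size T.
Proof.
have uK : vertex_kinds (vertex_kind u) by exists u.
have wK : vertex_kinds (vertex_kind w) by exists w.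
rewrite -!kind_valence_count// !handshake opprD addrACA -!sumrB big1 ?add0r.
  apply: le_trans (ler_norm_sum _ _ _) _; apply: ler_sum => e _.
  have b01 (a b c d : bool) : `|a%:R * b%:R - c%:R * d%:R| <= 1 :> R.
    by case: a b c d => [][][][]; rewrite ?(mulr1, mulr0, subr0, sub0r,
      normrN, subrr, normr1, normr0).
  by case: ifP => _; apply: b01.
move=> e _; rewrite !other_source !other_target; ring.
Qed.

Lemma kind_valence_gt0 u w : @Defs.adjacent G u w -> 0 < kind_valence u (vertex_kind w).
Proof.
move=> /asboolP[e eE].
have [eu ow] : e \in star u /\ other e u = w.
  rewrite in_star; case: eE => -[<- <-].
    by rewrite eqxx other_source.
  by rewrite eqxx orbT other_target.
rewrite /kind_valence (big_fsetD1 e)//= ow mem_set; last exact: vertex_kind_refl.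
by rewrite ltr_pwDl//; apply: sumr_ge0.
Qed.

Lemma adjacent_sym u w : @Defs.adjacent G u w -> @Defs.adjacent G w u.
Proof. by move=> /asboolP[e eE]; apply/asboolP; exists e; case: eE; auto. Qed.

(** Induction along a path from [u] to [w]; each step uses [edge_count_balance]. *)
Lemma kind_ratio (Gconn : connected_graph G) u w : exists c C : R,
  0 < c /\ forall T,
    `|count_in T (vertex_kind w) - c * count_in T (vertex_kind u)| <=
    C * boundary_size T.
Proof.
have [s [us <-]] := Gconn u w.
elim/last_ind: s us => [_|s x IHs]; first by
  exists 1, 0; split=> // T; rewrite mul1r subrr normr0 mul0r.
rewrite rcons_path last_rcons => /andP[/IHs[c [C [c0 cC]]] ux].
set y := last u s in ux cC.
have a0 := kind_valence_gt0 ux; have b0 := kind_valence_gt0 (adjacent_sym ux).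
set a := kind_valence y _ in a0; set b := kind_valence x _ in b0.
exists (a / b * c), ((1 + a * C) / b); split=> [|T]; first by rewrite mulr_gt0 ?divr_gt0.
have := edge_count_balance T y x; rewrite -/a -/b => h.
have := cC T; set nx := count_in T (vertex_kind x) in h *.
set ny := count_in T (vertex_kind y) in h *.
move=> h2; rewrite -(ler_pM2l b0).
have -> : b * ((1 + a * C) / b * boundary_size T) =
    boundary_size T + a * (C * boundary_size T).
  by field; rewrite gt_eqF.
rewrite -[X in X * _](gtr0_norm b0) -normrM.
have -> : b * (nx - a / b * c * count_in T (vertex_kind u)) =
   - (a * ny - b * nx) + a * (ny - c * count_in T (vertex_kind u)).
  by field; rewrite gt_eqF.
apply: le_trans (ler_normD _ _) _; rewrite normrN normrM (gtr0_norm a0).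
by apply: lerD => //; rewrite ler_pM2l.
Qed.

End Kinds.

(** * Densities along pinching sequences *)

Lemma card_setE (R : realType) (X : choiceType) (A : set X) (F : {fset X})
    (P : pred X) : (forall x, A x <-> x \in F /\ P x) ->
  card_set R A = \sum_(x <- F | P x) 1.
Proof.
move=> AP; have Afin : finite_set A.
  by apply: sub_finite_set (finite_fset F) => x /AP[].
rewrite /card_set -sum1_size natr_sum -[RHS]big_filter.
apply: perm_big; apply: uniq_perm; rewrite ?filter_uniq ?fset_uniq//.
move=> x; rewrite mem_filter in_fset_set// andbC.
by apply/idP/andP => [/set_mem/AP|/AP/mem_set].
Qed.

Section Decomposition.
Context (R : realType) (X : choiceType) (kind : X -> set X).
Hypothesis kind_fin : finite_set (range kind).
Hypothesis kindP : forall K x, range kind K -> (x \in K) = (K == kind x).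
Variable h : X -> R.
Hypothesis hkind : forall x y, kind x y -> h y = h x.

(** The summand of the kind of [x] is the only nonzero one, and there [xget]
returns [h x] because [h] is constant on kinds. *)
Lemma kind_decomposition x :
  h x = \sum_(K <- fset_set (range kind)) (x \in K)%:R * xget 0 (h @` K).
Proof.
have xK : kind x \in fset_set (range kind) by rewrite in_fset_set// inE; exists x.
have xx : kind x x by have := kindP x (imageT kind x); rewrite eqxx => /set_mem.
rewrite (big_fsetD1 _ xK)/= mem_set// mul1r big1_seq ?addr0.
  have hx : (h @` kind x) (h x) by exists x.
  by case: (xgetI 0 hx) => y /hkind <- ->.
move=> K /=; rewrite !inE => /andP[Kx]; rewrite in_fset_set// => /set_mem KK.
by rewrite kindP// (negbTE Kx) mul0r.
Qed.

Lemma average_limit (freq : set X -> R) (A : nat -> seq X) :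
  (forall K, range kind K ->
     (\sum_(x <- A n) (x \in K)%:R) / (\sum_(x <- A n) 1) @[n --> \oo]
       --> freq K) ->
  (\sum_(x <- A n) h x) / (\sum_(x <- A n) 1) @[n --> \oo] -->
    average (range kind) freq h.
Proof.
move=> Afreq; rewrite /average fsbig_finite//=.
have -> : (fun n => (\sum_(x <- A n) h x) / (\sum_(x <- A n) 1)) =
    (fun n => \sum_(K <- fset_set (range kind) | K \in fset_set (range kind))
      (\sum_(x <- A n) (x \in K)%:R) / (\sum_(x <- A n) 1) * xget 0 (h @` K)).
  apply/funext => n; under eq_bigr do rewrite kind_decomposition.
  rewrite exchange_big /= big_distrl /= [LHS]big_seq; apply: eq_bigr => K _.
  by rewrite -big_distrl /= mulrAC.
rewrite big_seq; apply: cvg_big => [|K]; first exact: add_continuous.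
by rewrite in_fset_set// inE => KK; apply: cvgMr_tmp; apply: Afreq.
Qed.
End Decomposition.

Section Density.
Context (R : realType) (G : multigraph).
Hypotheses (Ginf : infinite_graph G) (Gconn : connected_graph G)
  (Glf : locally_finite_graph G) (Gloopless : loopless G)
  (Gsym : symmetrical G).
Implicit Types (T : {fset vertex G}).
Local Notation bd := (@boundary_size G R).

(** The error is bounded by the boundary uniformly in [T]. Such bounds can be
added, pass from vertices to edges, and give the same limit along every
pinching sequence. *)
Definition has_density (h : vertex G -> R) (a : R) : Prop := exists C : R,
  forall T, `|\sum_(v <- T) h v - a * #|` T|%:R| <= C * bd T.

Definition has_edge_density (h : edge G -> R) (a : R) : Prop := exists C : R,
  forall T, `|\sum_(e <- touching T | inside T e) h e - a * #|` T|%:R| <=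
    C * bd T.

Lemma has_densityZ h a b : has_density h a ->
  has_density (fun v => h v * b) (a * b).
Proof.
case=> C hC; exists (C * `|b|) => T; rewrite -big_distrl /=.
by rewrite mulrAC -mulrBl normrM mulrAC ler_wpM2r.
Qed.

Lemma has_density_sum (I : Type) (r : seq I) (h : I -> vertex G -> R)
    (a : I -> R) : (forall i, has_density (h i) (a i)) ->
  has_density (fun v => \sum_(i <- r) h i v) (\sum_(i <- r) a i).
Proof.
move=> /choice[C hC]; exists (\sum_(i <- r) C i) => T.
rewrite exchange_big /= !big_distrl /= -sumrB.
by apply: le_trans (ler_norm_sum _ _ _) _; apply: ler_sum => i _.
Qed.

(** By [kind_ratio] the numbers of vertices of the kinds are proportional to fixed
positive weights up to the size of the boundary, and they add up to [#|T|]. *)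
Lemma kind_density K : vertex_kinds K ->
  exists a, has_density (fun v => (v \in K)%:R) a.
Proof.
case=> w _ <-; have [u _] := infinite_notin Ginf fset0.
have /choice[c] : forall L : set (vertex G), exists c : R * R, vertex_kinds L ->
    0 < c.1 /\ forall T,
    `|count_in R T L - c.1 * count_in R T (vertex_kind u)| <= c.2 * bd T.
  move=> L; have [[v _ <-]|LK] := pselect (vertex_kinds L).
    by have [c [C cC]] := kind_ratio Glf R Gloopless Gconn u v; exists (c, C).
  by exists 0.
move=> cP; pose Ks := fset_set (@vertex_kinds G).
have KsP L : L \in Ks -> vertex_kinds L by rewrite in_fset_set// inE.
pose s := \sum_(L <- Ks) (c L).1; pose C := \sum_(L <- Ks) (c L).2.
have wK : vertex_kinds (vertex_kind w) by exists w.
have s0 : 0 < s.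
  rewrite /s (big_fsetD1 (vertex_kind w)) ?in_fset_set ?inE//=.
  rewrite ltr_wpDr//; last exact: (cP _ wK).1.
  rewrite big_seq; apply: sumr_ge0 => L; rewrite !inE => /andP[_ /KsP/cP[/ltW]].
  by [].
have total T : `|#|` T|%:R - s * count_in R T (vertex_kind u)| <= C * bd T.
  have -> : #|` T|%:R = \sum_(L <- Ks) count_in R T L.
    rewrite exchange_big /= -sum1_size natr_sum; apply: eq_bigr => v _.
    rewrite (big_fsetD1 (vertex_kind v)) ?in_fset_set ?inE//=; last by exists v.
    rewrite mem_set; last exact: vertex_kind_refl.
    rewrite big1_seq ?addr0// => L /=; rewrite !inE => /andP[Lv /KsP LK].
    by rewrite mem_vertex_kinds// (negbTE Lv).
  rewrite /s /C !big_distrl -sumrB /= big_seq [leRHS]big_seq.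
  apply: le_trans (ler_norm_sum _ _ _) _.
  by apply: ler_sum => L /KsP/cP[_].
have [cw0 cw] := cP _ wK; set a := (c (vertex_kind w)).1 in cw0 cw.
exists (a / s), ((c (vertex_kind w)).2 + a / s * C) => T.
have as0 : 0 < a / s by rewrite divr_gt0.
have -> : \sum_(v <- T) (v \in vertex_kind w)%:R - a / s * #|` T|%:R =
    (count_in R T (vertex_kind w) - a * count_in R T (vertex_kind u)) +
    (- (a / s) * (#|` T|%:R - s * count_in R T (vertex_kind u))).
  by rewrite /count_in; field; rewrite gt_eqF.
apply: le_trans (ler_normD _ _) _; rewrite mulrDl; apply: lerD => //.
by rewrite normrM normrN (gtr0_norm as0) -(mulrA (a / s)) ler_pM2l.
Qed.

Lemma invariant_density (h : vertex G -> R) :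
  (forall f g v, @automorphism G f g -> h (f v) = h v) ->
  exists a, has_density h a.
Proof.
move=> hinv.
have /choice[a aP] : forall K, exists a, vertex_kinds K ->
    has_density (fun v => (v \in K)%:R) a.
  move=> K; have [/kind_density[a aK]|nK] := pselect (vertex_kinds K).
    by exists a.
  by exists 0.
have hE v := kind_decomposition Gsym (fun K x => mem_vertex_kinds x) (h := h) _ v.
pose Ks := fset_set (@vertex_kinds G).
pose hv (K : set (vertex G)) := xget 0 (h @` K).
exists (\sum_(K : Ks) a (val K) * hv (val K)).
have -> : h = (fun v => \sum_(K : Ks) (v \in val K)%:R * hv (val K)).
  apply/funext => v; rewrite [LHS]hE => [|x y [f [g [fg <-]]]]; last exact: hinv fg.
  by rewrite big_seq_fsetE.
apply: has_density_sum => K; apply: has_densityZ; apply: aP.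
by have := valP K; rewrite in_fset_set// inE.
Qed.

Lemma sum_boundary_norm T (h : edge G -> R) : (forall e, `|h e| <= 1) ->
  `|\sum_(e <- touching T | ~~ inside T e) h e| <= bd T.
Proof.
move=> h1; apply: le_trans (ler_norm_sum _ _ _) _.
by apply: ler_sum => e _; apply: h1.
Qed.

Lemma star_sum T (h : edge G -> R) :
  \sum_(v <- T) \sum_(e <- star v) h e =
  2 * \sum_(e <- touching T | inside T e) h e +
  \sum_(e <- touching T | ~~ inside T e) h e.
Proof.
rewrite (handshake Glf Gloopless T (fun _ => h)); congr (_ + _).
  by rewrite big_distrr /=; apply: eq_bigr => e _; rewrite mulr2n mulrDl mul1r.
by apply: eq_bigr => e _; case: ifP.
Qed.

(** By the handshake count the sum over stars is twice the sum over the inner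
edges, up to the boundary. *)
Lemma star_density (h : edge G -> R) a : (forall e, `|h e| <= 1) ->
  has_density (fun v => \sum_(e <- star v) h e) a ->
  has_edge_density h (a / 2).
Proof.
move=> h1 [C hC]; exists ((C + 1) / 2) => T.
have := hC T; have := sum_boundary_norm T h1; rewrite star_sum => h2 h3.
have -> : \sum_(e <- touching T | inside T e) h e - a / 2 * #|` T|%:R =
  2^-1 * (2 * \sum_(e <- touching T | inside T e) h e +
      \sum_(e <- touching T | ~~ inside T e) h e - a * #|` T|%:R) +
  - 2^-1 * \sum_(e <- touching T | ~~ inside T e) h e by field.
apply: le_trans (ler_normD _ _) _; rewrite !normrM normrN.
have i2 : `|2^-1| = 2^-1 :> R by rewrite gtr0_norm ?invr_gt0.
rewrite i2; lra.
Qed.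

Lemma invariant_edge_density (h : edge G -> R) : (forall e, `|h e| <= 1) ->
  (forall f g e, @automorphism G f g -> h (g e) = h e) ->
  exists a, has_edge_density h a.
Proof.
move=> h1 hinv.
have [|a aP] := @invariant_density (fun v => \sum_(e <- star v) h e).
  move=> f g v fg; rewrite (sum_star_auto Glf _ _ fg).
  by apply: eq_bigr => e _; apply: hinv fg.
by exists (a / 2); apply: star_density.
Qed.

Lemma valenceE (v : vertex G) : valence R v = \sum_(e <- star v) 1.
Proof.
apply: card_setE => e; rewrite /star in_fset_set//.
by split=> [/mem_set|[/set_mem]].
Qed.

Lemma edge_boundary_size T : card_set R (edge_boundary T) = bd T.
Proof.
apply: card_setE => e; rewrite in_touching// /edge_boundary /touches /inside /=.
by do 2!case: (_ \in T); split=> // -[].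
Qed.

Section Pinching.
Variable T : nat -> {fset vertex G}.
Hypothesis Tpinch : pinching R T.

Lemma pinching_neq0 : \forall n \near \oo, (0 < #|` T n|%:R :> R).
Proof.
have [u _] := infinite_notin Ginf fset0; have [Tsw _] := Tpinch.
apply: filterS (Tsw [fset u]%fset) => n /fsubset_leq_card.
by rewrite cardfs1 ltr0n.
Qed.

Lemma pinching_limit (x : nat -> R) a C :
  (forall n, `|x n - a * #|` T n|%:R| <= C * bd (T n)) ->
  x n / #|` T n|%:R @[n --> \oo] --> a.
Proof.
move=> xC; have [_ bT] := Tpinch.
apply/subr_cvg0.
have Cb0 : C * (card_set R (edge_boundary (T n)) / card_set R [set` T n])
    @[n --> \oo] --> (0 : R) by rewrite -[X in _ --> X](mulr0 C); apply: cvgMl_tmp.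
apply/norm_cvg0P; apply: squeeze_cvgr Cb0; last exact: cvg_cst.
apply: filterS pinching_neq0 => n Tn0; rewrite normr_ge0 /=.
rewrite edge_boundary_size /card_set set_fsetK mulrA ler_pdivlMr//.
rewrite -[X in _ * X](gtr0_norm Tn0) -normrM mulrBl divfK ?gt_eqF//.
Qed.


Lemma density_limit h a : has_density h a ->
  (\sum_(v <- T n) h v) / #|` T n|%:R @[n --> \oo] --> a.
Proof. by case=> C hC; apply: (@pinching_limit _ _ C) => n; apply: hC. Qed.

Lemma edge_density_limit h a : has_edge_density h a ->
  (\sum_(e <- touching (T n) | inside (T n) e) h e) / #|` T n|%:R
    @[n --> \oo] --> a.
Proof. by case=> C hC; apply: (@pinching_limit _ _ C) => n; apply: hC. Qed.
End Pinching.

Lemma exists_neighbor (v : vertex G) : exists w, @Defs.adjacent G v w.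
Proof.
have [w wv] := infinite_notin Ginf [fset v]%fset.
have [[|x s] /= [vs sw]] := Gconn v w; first by rewrite -sw inE eqxx in wv.
by exists x; case/andP: vs.
Qed.

Lemma valence_ge1 (v : vertex G) : 1 <= valence R v.
Proof.
have [w /asboolP[e evw]] := exists_neighbor v.
have ev : e \in star v by rewrite in_star//; case: evw => -[-> ->]; rewrite eqxx ?orbT.
by rewrite valenceE (big_fsetD1 e)//= lerDl sumr_ge0.
Qed.

Lemma valence_auto f g v : @automorphism G f g -> valence R (f v) = valence R v.
Proof. by move=> fg; rewrite !valenceE (sum_star_auto Glf _ _ fg). Qed.

Lemma proportion_vertex T K : proportion R [set` T] K =
  (\sum_(v <- T) (v \in K)%:R) / #|` T|%:R.
Proof.
rewrite /proportion /card_set set_fsetK; congr (_ / _).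
rewrite -/(card_set R _) (@card_setE _ _ _ T (fun v => v \in K)) => [|v].
  by rewrite big_mkcond; apply: eq_bigr => v _; case: (_ \in _).
by split=> [[vT /mem_set vK]|[vT /set_mem vK]].
Qed.

Lemma proportion_edge T K : proportion R [set e | inside T e] K =
  (\sum_(e <- touching T | inside T e) (e \in K)%:R) /
  (\sum_(e <- touching T | inside T e) 1).
Proof.
have iT e : inside T e -> e \in touching T.
  by move=> eT; rewrite in_touching// inside_touches.
rewrite /proportion; congr (_ / _); last first.
  by apply: card_setE => e; split=> [/= eT|[]//]; split=> //; apply: iT.
rewrite (@card_setE _ _ _ (touching T) (fun e => inside T e && (e \in K))) => [|e].
  rewrite [LHS]big_mkcond [RHS]big_mkcond; apply: eq_bigr => e _.
  by case: (inside T e); case: (e \in K).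
split=> [[/= eT /mem_set ->]|[_ /andP[eT /set_mem eK]]//].
by rewrite eT; split=> //; apply: iT.
Qed.

Lemma vertex_frequency_limit (T : nat -> {fset vertex G}) K :
  pinching R T -> vertex_kinds K ->
  (\sum_(v <- T n) (v \in K)%:R) / #|` T n|%:R @[n --> \oo] -->
    vertex_frequency R K.
Proof.
move=> Tp KK; have [a aK] := kind_density KK.
rewrite /vertex_frequency.
have : [set x | forall T : nat -> {fset vertex G}, pinching R T ->
    proportion R [set` T n] K @[n --> \oo] --> x] a.
  move=> U Up; under eq_cvg do rewrite proportion_vertex.
  exact: density_limit.
by move=> /(xgetI 0)/(_ T Tp); under eq_cvg do rewrite proportion_vertex.
Qed.

Section Average.
Variable T : nat -> {fset vertex G}.
Hypothesis Tp : pinching R T.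

Lemma average_vertex_limit (h : vertex G -> R) :
  (forall f g v, @automorphism G f g -> h (f v) = h v) ->
  (\sum_(v <- T n) h v) / #|` T n|%:R @[n --> \oo] -->
    average (@vertex_kinds G) (@vertex_frequency R G) h.
Proof.
move=> hinv.
have sE S : #|` S|%:R = \sum_(v <- S) 1 :> R by rewrite -sum1_size natr_sum.
under eq_cvg do rewrite sE.
apply: (average_limit Gsym (fun K x => @mem_vertex_kinds _ _ x)) => [x y|K KK].
  by case=> f [g [fg <-]]; apply: hinv fg.
by have := vertex_frequency_limit Tp KK; under eq_cvg do rewrite sE.
Qed.

Lemma average_valence_density : has_density (@valence R G) (average_valence R G).
Proof.
have [a aV] := invariant_density valence_auto.
suff -> : average_valence R G = a by [].
exact: (cvg_unique (@norm_hausdorff _ _) (average_vertex_limit valence_auto)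
  (density_limit Tp aV)).
Qed.

Lemma average_valence_ge1 : 1 <= average_valence R G.
Proof.
apply: (cvgr_to_ge (density_limit Tp average_valence_density)).
apply: filterS (pinching_neq0 Tp) => n Tn; rewrite ler_pdivlMr// mul1r.
rewrite -sum1_size natr_sum; apply: ler_sum => v _; exact: valence_ge1.
Qed.

Lemma edge_count_density :
  has_edge_density (fun=> 1) (average_valence R G / 2).
Proof.
apply: star_density => [e|]; first by rewrite normr1.
have := average_valence_density; congr (has_density _ _).
by apply/funext => v; rewrite valenceE.
Qed.
Lemma edge_frequency_limit K : edge_kinds K ->
  (\sum_(e <- touching (T n) | inside (T n) e) (e \in K)%:R) /
  (\sum_(e <- touching (T n) | inside (T n) e) 1) @[n --> \oo] -->
    edge_frequency R K.
Proof.
move=> KK; have [a aK] : exists a, has_edge_density (fun e => (e \in K)%:R) a.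
  apply: invariant_edge_density => [e|f g e fg].
    by case: (e \in K); rewrite ?normr0 ?normr1.
  by rewrite !mem_edge_kinds// (edge_kind_auto _ fg).
have b0 : 0 < average_valence R G / 2.
  by rewrite divr_gt0// (lt_le_trans ltr01 average_valence_ge1).
have b1 := edge_count_density.
set b := _ / 2 in b0 b1.
rewrite /edge_frequency.
have : [set x | forall T : nat -> {fset vertex G}, pinching R T ->
    proportion R [set e | inside (T n) e] K @[n --> \oo] --> x] (a / b).
  move=> U Up; under eq_cvg do rewrite proportion_edge.
  pose x n : R := \sum_(e <- touching (U n) | inside (U n) e) (e \in K)%:R.
  pose y n : R := \sum_(e <- touching (U n) | inside (U n) e) 1.
  have xy : (x n / #|` U n|%:R) * (y n / #|` U n|%:R)^-1 @[n --> \oo] --> a / b.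
    apply: cvgM; first exact: (edge_density_limit Up aK).
    by apply: cvgV; [exact: lt0r_neq0|exact: (edge_density_limit Up b1)].
  apply: cvg_trans xy; apply: near_eq_cvg.
  apply: filterS (pinching_neq0 Up) => n Un.
  by rewrite /= invf_div mulrA divfK ?gt_eqF.
by move=> /(xgetI 0)/(_ T Tp); under eq_cvg do rewrite proportion_edge.
Qed.

Lemma average_edge_limit (h : edge G -> R) :
  (forall f g e, @automorphism G f g -> h (g e) = h e) ->
  (\sum_(e <- touching (T n) | inside (T n) e) h e) /
  (\sum_(e <- touching (T n) | inside (T n) e) 1) @[n --> \oo] -->
    average (@edge_kinds G) (@edge_frequency R G) h.
Proof.
move=> hinv.
pose A n := [seq e <- touching (T n) | inside (T n) e].
have AE (k : edge G -> R) n :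
    \sum_(e <- touching (T n) | inside (T n) e) k e = \sum_(e <- A n) k e.
  by rewrite big_filter.
under eq_cvg do rewrite !AE.
apply: (average_limit (finite_edge_kinds Glf Gsym)
  (fun K x => @mem_edge_kinds _ _ x)) => [x y|K KK].
  by case=> f [g [fg <-]]; apply: hinv fg.
by have := edge_frequency_limit KK; under eq_cvg do rewrite !AE.
Qed.

End Average.

End Density.

(** * The squeeze *)

Section Foster.
Context (R : realType) (G : multigraph).
Hypotheses (Ginf : infinite_graph G) (Gconn : connected_graph G)
  (Glf : locally_finite_graph G) (Gloopless : loopless G)
  (Gsym : symmetrical G).
Variable T : nat -> {fset vertex G}.
Hypothesis Tp : pinching R T.
Let Tsw : swelling T := proj1 Tp.

Lemma edge_count_limit :
  (\sum_(e <- touching (T n) | inside (T n) e) 1) / #|` T n|%:R @[n --> \oo]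
    --> average_valence R G / 2.
Proof.
exact: (edge_density_limit Ginf Glf Tp
  (edge_count_density Ginf Gconn Glf Gloopless Gsym Tp)).
Qed.

Lemma half_valence_neq0 : average_valence R G / 2 != 0.
Proof.
have := average_valence_ge1 Ginf Gconn Glf Gloopless Gsym Tp.
by move=> V1; rewrite gt_eqF// divr_gt0// (lt_le_trans ltr01).
Qed.

Lemma inv_edge_count_limit :
  #|` T n|%:R / (\sum_(e <- touching (T n) | inside (T n) e) 1) @[n --> \oo]
    --> 2 / average_valence R G.
Proof.
rewrite -invf_div; under eq_cvg do rewrite -invf_div.
by apply: cvgV; [exact: half_valence_neq0|exact: edge_count_limit].
Qed.

Lemma average_even_le : average_even_resistance R G <= 2 / average_valence R G.
Proof.
have even_inv f g e := @even_auto R G Glf T Tsw f g e.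
have evenT := average_edge_limit Ginf Gconn Glf Gloopless Gsym Tp even_inv.
apply: (ler_cvg_to evenT inv_edge_count_limit); apply: nearW => n /=.
rewrite ler_wpM2r ?invr_ge0 ?sumr_ge0//.
exact: sum_even_le.
Qed.

(** The boundary term of [sum_odd_ge] is negligible along a pinching sequence. *)
Lemma average_odd_ge : 2 / average_valence R G <= average_odd_resistance R G.
Proof.
have odd_inv f g e := @odd_auto R G Glf Gconn Ginf T Tsw f g e.
have oddT := average_edge_limit Ginf Gconn Glf Gloopless Gsym Tp odd_inv.
have bd1 : (1 - boundary_size R (T n) / #|` T n|%:R) *
    (#|` T n|%:R / (\sum_(e <- touching (T n) | inside (T n) e) 1))
    @[n --> \oo] --> 2 / average_valence R G.
  rewrite -[X in _ --> X]mul1r; apply: cvgM; last exact: inv_edge_count_limit.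
  rewrite -[X in _ --> X]subr0; apply: cvgB; first exact: cvg_cst.
  have := Tp.2; apply: cvg_trans; apply: near_eq_cvg; apply: nearW => n.
  by rewrite edge_boundary_size// /card_set set_fsetK.
apply: (ler_cvg_to bd1 oddT).
apply: filterS (pinching_neq0 Ginf Tp) => n Tn /=; rewrite mulrA.
rewrite ler_wpM2r ?invr_ge0 ?sumr_ge0// mulrBl mul1r divfK ?gt_eqF//.
exact: sum_odd_ge.
Qed.

Lemma average_odd_le_even :
  average_odd_resistance R G <= average_even_resistance R G.
Proof.
have even_inv f g e := @even_auto R G Glf T Tsw f g e.
have odd_inv f g e := @odd_auto R G Glf Gconn Ginf T Tsw f g e.
have evenT := average_edge_limit Ginf Gconn Glf Gloopless Gsym Tp even_inv.
have oddT := average_edge_limit Ginf Gconn Glf Gloopless Gsym Tp odd_inv.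
apply: (ler_cvg_to oddT evenT); apply: nearW => n /=.
rewrite ler_wpM2r ?invr_ge0 ?sumr_ge0//; apply: ler_sum => e _.
exact: odd_le_even.
Qed.
End Foster.

Theorem mainTheorem1 (R : realType) (G : multigraph)
    (Ginf : infinite_graph G)
    (Gconn : connected_graph G)
    (Glf : locally_finite_graph G)
    (Gloopless : loopless G)
    (Gsmallish : smallish R G)
    (Gsym : symmetrical G) :
  average_even_resistance R G = average_odd_resistance R G /\
  average_odd_resistance R G = 2 / average_valence R G.
Proof.
have [T Tp] := Gsmallish.
have odd_even := average_odd_le_even Ginf Gconn Glf Gloopless Gsym Tp.
have even_le := average_even_le Ginf Gconn Glf Gloopless Gsym Tp.
have odd_ge := average_odd_ge Ginf Gconn Glf Gloopless Gsym Tp.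
split; apply/le_anti/andP; split.
- exact: (le_trans even_le odd_ge).
- exact: odd_even.
- exact: (le_trans odd_even even_le).
- exact: odd_ge.
Qed.
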